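(* Let $D,k\ge 1$, let $(X,\mu)$ be a standard Borel probability space, let $\tau:\mathbb{R}^D\curvearrowright (X,\mu)$ be a jointly measurable $\mu$-preserving action, and let $\mathbf{p}_1,\mathbf{p}_2,\ldots,\mathbf{p}_k:\mathbb{R}\to\mathbb{R}^D$ be polynomial maps. Then for any $f_1,f_2,\ldots,f_k\in L^\infty(\mu)$ the multiple ergodic averages \[A_T(f_1,f_2,\ldots,f_k) := \frac{1}{T}\int_0^T \prod_{i=1}^k \big(f_i\circ \tau^{\mathbf{p}_i(t)}\big)\,\mathrm{d} t\] converge in the norm of $L^2(\mu)$ as $T\to\infty$.
   Context: An action $\tau:\mathbb{R}^D\curvearrowright (X,\mu)$, written $\mathbf{v}\mapsto \tau^{\mathbf{v}}$, is jointly measurable if $(\mathbf{v},x)\mapsto \tau^{\mathbf{v}}(x)$ is measurable on $\mathbb{R}^D\times X$, and is $\mu$-preserving if every $\tau^{\mathbf{v}}$ preserves $\mu$. A map $\mathbb{R}\to\mathbb{R}^D$ is polynomial if each of its coordinates is a real polynomial. The integral of the $L^2(\mu)$-valued function is the usual (Bochner, equivalently pointwise a.e.) integral. *)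

(* Defs.v *)
From HB Require Import structures.
From mathcomp Require Import all_boot all_order all_algebra.
From mathcomp Require Import complex.
From mathcomp Require Import all_classical all_reals all_analysis.

Set Implicit Arguments.
Unset Strict Implicit.
Unset Printing Implicit Defensive.

Import Order.TTheory GRing.Theory Num.Theory.
Import numFieldNormedType.Exports.

Local Open Scope classical_set_scope.
Local Open Scope ring_scope.

Definition polish_space (R : realType) (Y : metricType R) : Prop :=
  (exists2 S : set Y, countable S & dense S) /\
  (forall F : set_system Y, ProperFilter F -> cauchy F ->
     exists y : Y, F --> y).

(* A Borel space is standard when it is isomorphic, through [phi], to a Polish
   space with its Borel sigma-algebra [<<s open >>]. *)
Definition standard_borel (R : realType) d (X : measurableType d) : Prop :=
  exists (Y : metricType R) (phi : X -> Y),
    [/\ polish_space Y, bijective phi &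
        forall A : set X,
          measurable A <-> exists2 B : set Y, <<s open >> B & A = phi @^-1` B].

(* R^D with its Borel sigma-algebra; the carrier is 'rV[R]_D. *)
Definition borel_rV (R : realType) (D : nat) :=
  g_sigma_algebraType (@open 'rV[R]_D).

Section action.
Context (R : realType) (D : nat) d (X : measurableType d).
Variable tau : 'rV[R]_D -> X -> X.

Definition rV_action : Prop :=
  (forall x, tau 0 x = x) /\
  (forall u v x, tau (u + v) x = tau u (tau v x)).

Definition jointly_measurable : Prop :=
  measurable_fun [set: borel_rV R D * X] (fun vx => tau vx.1 vx.2).

Definition preserves_measure (mu : {measure set X -> \bar R}) : Prop :=
  forall (v : 'rV[R]_D) (A : set X),
    measurable A -> mu (tau v @^-1` A) = mu A.

End action.

Definition polynomial_map (R : realType) (D : nat) (p : R -> 'rV[R]_D) : Prop :=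
  forall j : 'I_D, exists q : {poly R}, forall t, p t ord0 j = q.[t].

(* [Lfun], the integral and ['N[mu]_q] of the library are for real-valued
   functions: the complex versions below go through the real and imaginary
   parts, and the modulus [Normc.normc : R[i] -> R]. *)
Section complex_valued.
Context (R : realType) d (X : measurableType d).
Variable mu : {measure set X -> \bar R}.

Definition complex_Lfun (q : \bar R) (f : X -> R[i]) : Prop :=
  ((fun x => complex.Re (f x)) \in Lfun mu q) /\
  ((fun x => complex.Im (f x)) \in Lfun mu q).

Definition complex_integral (A : set X) (f : X -> R[i]) : R[i] :=
  Complex (\int[mu]_(x in A) complex.Re (f x))
          (\int[mu]_(x in A) complex.Im (f x)).

Definition complex_Lnorm (q : \bar R) (f : X -> R[i]) : \bar R :=
  Lnorm mu q (fun x => (ComplexField.Normc.normc (f x))%:E).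

End complex_valued.

(* The integral over [0, T] is taken pointwise in x.  For essentially bounded
   f_i the integrand is integrable for almost every x (Fubini); on the
   remaining null set the value is an irrelevant default. *)
Definition ergodic_average (R : realType) (D k : nat) d (X : measurableType d)
    (tau : 'rV[R]_D -> X -> X) (p : 'I_k -> R -> 'rV[R]_D)
    (f : 'I_k -> X -> R[i]) (T : R) (x : X) : R[i] :=
  real_complex R T^-1 *
  complex_integral lebesgue_measure `[0, T]
    (fun t : R => \prod_(i < k) f i (tau (p i t) x)).

Definition cvg_in_L2 (R : realType) d (X : measurableType d)
    (mu : {measure set X -> \bar R}) (A : R -> X -> R[i]) : Prop :=
  exists2 g : X -> R[i], complex_Lfun mu 2%:E g &
    complex_Lnorm mu 2%:E (fun x => A T x - g x) @[T --> +oo] --> 0%E.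

(* Main.v *)
Require Import Defs.
From mathcomp Require Import all_boot all_order all_algebra ring lra.
From mathcomp Require Import complex.
From mathcomp Require Import all_classical all_reals all_analysis.
From mathcomp Require Import ess_sup_inf measurable_realfun.
Set Implicit Arguments.
Unset Strict Implicit.
Unset Printing Implicit Defensive.
Import Order.TTheory GRing.Theory Num.Theory.
Import numFieldNormedType.Exports.
Local Open Scope classical_set_scope.
Local Open Scope ring_scope.

(** The integral from 0 to N is the integral over s in [0, 1] of the sum over
    integers n < N of the integrand at n + s.  For fixed s the sequences
    n |-> p_i(n + s) are polynomial sequences in the abelian group R^D, so it
    suffices to prove norm convergence of discrete polynomial averages in an
    abelian group of measure-preserving maps; dominated convergence in s then
    gives the Cauchy property of the continuous averages.

    The discrete statement follows Walsh.  Fix all functions but the last, g,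
    which is moved by the sequence c.  The functions u in place of g for which
    the averages A_N(u) are Cauchy form a subspace; let u = g - z with z nearly
    a best approximation of g in it.  If A_N(u) were not small for arbitrarily
    large N, then b = A_N(u) satisfies <u, s> = |b|^2, where s is the average
    over m <= N of the c(m)^-1 translate of b * prod_i p_i(m) f_i.  Replacing m
    by m + t changes s by O(t / N), so A_K(s) is, for K much smaller than N, an
    average over m of polynomial averages along p_i, along c(t) - c(m + t) and
    along p_i(m + t) + c(t) - c(m + t); by induction these are Cauchy, so s lies
    in the subspace, and near-orthogonality of u to s is contradicted.  The
    comparison of K and N is made precise by letting N tend to infinity along an
    ultrafilter.

    For the induction, cover the sequences by balls (c, r), where h belongs to
    the ball when h - c has degree at most r.  The reduction applied to a ball
    of radius 0 deletes it, since each new sequence stays in the ball of the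
    p_i it comes from, and a ball of radius e + 1 is split into finitely many
    balls of radius e. *)

(** * Limits along an ultrafilter *)

Lemma ultra_fmap (S T : Type) (f : S -> T) (F : set_system S) :
  UltraFilter F -> UltraFilter (f @ F).
Proof.
move=> FU; split; first exact: fmap_proper_filter.
move=> G GF sFG; rewrite predeqE => A; split; last exact: sFG.
move=> GA; have [//|FnA] := in_ultra_setVsetC (f @^-1` A) FU.
have GnA : G (~` A) by apply: sFG.
by have /filter_ex[x []] : G (A `&` ~` A) by exact: filterI.
Qed.

Section ultralimit.
Context {R : realType} {U : set_system nat} {UU : UltraFilter U}.
Implicit Types u v : nat -> R.

Definition bounded_seq u := exists C, forall n, `|u n| <= C.

Definition ulim u := lim (u n @[n --> U]).

(** Compactness of the segment [[- C, C]]: every ultrafilter on it converges. *)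
Lemma ulim_cvg u : bounded_seq u -> u n @[n --> U] --> ulim u.
Proof.
move=> [C uC]; have := @segment_compact R (- C) C.
rewrite compact_ultra => /(_ (u @ U) (ultra_fmap u UU)) [].
  by apply: (@filterE _ U) => n; rewrite /= in_itv/= -ler_norml.
by move=> l [_ ul]; apply/cvg_ex; exists l.
Qed.

Lemma ulim_unique u l : u n @[n --> U] --> l -> ulim u = l.
Proof. by move=> ul; apply: cvg_lim. Qed.

Lemma ulim_cst (c : R) : ulim (fun=> c) = c.
Proof. by apply: ulim_unique; exact: cvg_cst. Qed.

Lemma ulimD u v : bounded_seq u -> bounded_seq v ->
  ulim (fun n => u n + v n) = ulim u + ulim v.
Proof.
by move=> bu bv; apply: ulim_unique; apply: cvgD; exact: ulim_cvg.
Qed.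

Lemma ulimZ c u : bounded_seq u -> ulim (fun n => c * u n) = c * ulim u.
Proof.
by move=> bu; apply: ulim_unique; apply: cvgM; [exact: cvg_cst|exact: ulim_cvg].
Qed.

Lemma ulim_ge c u : bounded_seq u -> (\near U, c <= u U) -> c <= ulim u.
Proof. by move=> bu; apply: limr_ge; exact: ulim_cvg. Qed.

Lemma ulim_le u v : bounded_seq u -> bounded_seq v ->
  (\forall n \near U, u n <= v n) -> ulim u <= ulim v.
Proof. by move=> bu bv; apply: ler_lim; exact: ulim_cvg. Qed.

Lemma ulim_near_gt c u : bounded_seq u -> c < ulim u ->
  \forall n \near U, c < u n.
Proof. by move=> bu; apply: cvgr_gt; exact: ulim_cvg. Qed.

End ultralimit.

(** * States and Cesaro means *)

Record function_algebra (R : realType) (T : Type) (L : (T -> R) -> Prop) :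
    Prop := FunctionAlgebra {
  fa_cst : forall c, L (fun=> c) ;
  fa_add : forall f g, L f -> L g -> L (fun x => f x + g x) ;
  fa_mul : forall f g, L f -> L g -> L (fun x => f x * g x) }.

(** A normalised positive linear functional. Integrals, Cesaro means and the expectation along the
    ultrafilter are all handled as states, so that Jensen's inequality [st_sqr] is proved once. *)
Record state (R : realType) (T : Type) (L : (T -> R) -> Prop)
    (m : (T -> R) -> R) : Prop := State {
  st_alg : function_algebra L ;
  st_add : forall f g, L f -> L g -> m (fun x => f x + g x) = m f + m g ;
  st_scale : forall c f, L f -> m (fun x => c * f x) = c * m f ;
  st_ge0 : forall f, L f -> (forall x, 0 <= f x) -> 0 <= m f ;
  st_one : m (fun=> 1) = 1 }.

(** * Inequalities for states *)

Section algebra_theory.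
Context {R : realType} {T : Type} {L : (T -> R) -> Prop}.
Hypothesis AL : function_algebra L.

Lemma fa_scale c f : L f -> L (fun x => c * f x).
Proof. by move=> Lf; apply: (fa_mul AL) => //; exact: (fa_cst AL). Qed.

Lemma fa_sub f g : L f -> L g -> L (fun x => f x - g x).
Proof.
move=> Lf Lg; rewrite [X in L X](_ : _ = fun x => f x + -1 * g x).
  by apply: (fa_add AL) => //; exact: fa_scale.
by apply/funext => x; rewrite mulN1r.
Qed.

Lemma fa_sqr f : L f -> L (fun x => f x ^+ 2).
Proof. by move=> Lf; exact: (fa_mul AL Lf Lf). Qed.

Lemma fa_sum (J : Type) (r : seq J) (f : J -> T -> R) :
  (forall j, L (f j)) -> L (fun x => \sum_(j <- r) f j x).
Proof.
move=> Lf; elim: r => [|j r IH].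
  by rewrite [X in L X](_ : _ = fun=> 0);
    [exact: (fa_cst AL)|apply/funext => x; rewrite big_nil].
rewrite [X in L X](_ : _ = fun x => f j x + \sum_(j <- r) f j x).
  exact: (fa_add AL).
by apply/funext => x; rewrite big_cons.
Qed.

Variable m : (T -> R) -> R.
Hypothesis Sm : state L m.

Lemma st_sub f g : L f -> L g -> m (fun x => f x - g x) = m f - m g.
Proof.
move=> Lf Lg; rewrite -mulN1r -(st_scale Sm)// -(st_add Sm)//; last exact: fa_scale.
by congr m; apply/funext => x; rewrite mulN1r.
Qed.

Lemma st_le f g : L f -> L g -> (forall x, f x <= g x) -> m f <= m g.
Proof.
move=> Lf Lg fg; rewrite -subr_ge0 -st_sub//; apply: (st_ge0 Sm).
  exact: fa_sub.
by move=> x; rewrite subr_ge0.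
Qed.

Lemma st_cst c : m (fun=> c) = c.
Proof.
rewrite -[RHS]mulr1 -(st_one Sm) -(st_scale Sm); last exact: (fa_cst AL).
by congr m; apply/funext => x; rewrite mulr1.
Qed.

Lemma st_le_cst f c : L f -> (forall x, f x <= c) -> m f <= c.
Proof. by move=> Lf fc; rewrite -[leRHS]st_cst; apply: st_le => //; exact: (fa_cst AL). Qed.

Lemma st_norm f c : L f -> (forall x, `|f x| <= c) -> `|m f| <= c.
Proof.
move=> Lf fc; rewrite ler_norml; apply/andP; split.
  rewrite -[leLHS]st_cst; apply: st_le => //; first exact: (fa_cst AL).
  by move=> x; have := fc x; rewrite ler_norml => /andP[].
by apply: st_le_cst => // x; have := fc x; rewrite ler_norml => /andP[].
Qed.

(** Expand the variance, the value of [m] at the square of [f - m f], which is nonnegative. *)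
Lemma st_sqr f : L f -> m f ^+ 2 <= m (fun x => f x ^+ 2).
Proof.
move=> Lf; set a := m f.
have : 0 <= m (fun x => (f x - a) ^+ 2).
  apply: (st_ge0 Sm) => [|x]; last exact: sqr_ge0.
  by apply/fa_sqr/fa_sub => //; exact: (fa_cst AL).
rewrite [X in m X](_ : _ = fun x => f x ^+ 2 + ((- 2 * a) * f x + a ^+ 2)).
  have L2 := fa_sqr Lf; have La := fa_scale (- 2 * a) Lf.
  have Lc := fa_cst AL (a ^+ 2).
  rewrite (st_add Sm)//; last exact: (fa_add AL).
  rewrite (st_add Sm)// (st_scale Sm)// st_cst -/a.
  set y := m _ => ?; nra.
by apply/funext => x; ring.
Qed.

Lemma st_sum (J : Type) (r : seq J) (f : J -> T -> R) :
  (forall j, L (f j)) ->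
  m (fun x => \sum_(j <- r) f j x) = \sum_(j <- r) m (f j).
Proof.
move=> Lf; elim: r => [|j r IH].
  rewrite big_nil -[RHS]st_cst; congr m.
  by apply/funext => x; rewrite big_nil.
rewrite big_cons -IH -(st_add Sm)//; last exact: fa_sum.
by congr m; apply/funext => x; rewrite big_cons.
Qed.

End algebra_theory.

Section cesaro.
Context {R : realType}.
Implicit Types (N : nat) (u : nat -> R).

(** There are [N.+1] terms, so the divisor is nonzero for every [N]. *)
Definition cesaro N u := N.+1%:R^-1 * \sum_(t < N.+1) u t.

Lemma state_cesaro N : state (fun _ => True) (cesaro N).
Proof.
split=> //.
- by move=> f g _ _; rewrite /cesaro big_split mulrDr.
- by move=> c f _; rewrite /cesaro -mulr_sumr mulrCA.
- by move=> f _ f0; rewrite /cesaro mulr_ge0 ?invr_ge0 ?sumr_ge0.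
- by rewrite /cesaro sumr_const card_ord mulVf // pnatr_eq0.
Qed.

Lemma function_algebra_full T : function_algebra (fun _ : T -> R => True).
Proof. by []. Qed.

(** Unlike [st_le], this compares only on the averaged range. *)
Lemma cesaro_le N u v : (forall t, (t <= N)%N -> u t <= v t) ->
  cesaro N u <= cesaro N v.
Proof.
move=> uv; rewrite /cesaro ler_wpM2l ?invr_ge0//; apply: ler_sum => i _.
by apply: uv; rewrite -ltnS.
Qed.

Lemma cesaro_norm N u C : (forall t, (t <= N)%N -> `|u t| <= C) ->
  `|cesaro N u| <= C.
Proof.
move=> uC; have Sc := state_cesaro N.
rewrite ler_norml -(st_cst (function_algebra_full _) Sc C).
apply/andP; split; last first.
  by apply: cesaro_le => t /uC; rewrite ler_norml => /andP[].
rewrite -mulN1r -(st_scale Sc)//.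
by apply: cesaro_le => t /uC; rewrite ler_norml mulN1r => /andP[].
Qed.

Lemma cesaroZ N c u : cesaro N (fun t => c * u t) = c * cesaro N u.
Proof. exact: (st_scale (state_cesaro N)). Qed.

Lemma cesaroD N u v :
  cesaro N (fun t => u t + v t) = cesaro N u + cesaro N v.
Proof. exact: (st_add (state_cesaro N)). Qed.

Lemma cesaroB N u v :
  cesaro N (fun t => u t - v t) = cesaro N u - cesaro N v.
Proof. exact: (st_sub (function_algebra_full _) (state_cesaro N)). Qed.

Lemma cesaro_cst N c : cesaro N (fun=> c) = c.
Proof. exact: (st_cst (function_algebra_full _) (state_cesaro N)). Qed.

Lemma cesaro_sqr N u : cesaro N u ^+ 2 <= cesaro N (fun t => u t ^+ 2).
Proof. exact: (st_sqr (function_algebra_full _) (state_cesaro N)). Qed.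

Lemma exchange_cesaro N N' (u : nat -> nat -> R) :
  cesaro N (fun t => cesaro N' (u t)) =
  cesaro N' (fun m => cesaro N (fun t => u t m)).
Proof.
rewrite /cesaro -!mulr_sumr exchange_big /= mulrCA.
by congr (_ * _); rewrite -!mulr_sumr.
Qed.

(** A shift by one trades the first term for a new last one, at cost [2 * C / N.+1]; induction adds
    up [k] such costs. *)
Lemma cesaro_shift N u C k : (forall t, `|u t| <= C) ->
  `|cesaro N u - cesaro N (fun t => u (t + k)%N)| <= k%:R * (2 * C / N.+1%:R).
Proof.
move=> uC; elim: k => [|k IH].
  rewrite mul0r (_ : (fun t => u (t + 0)%N) = u) ?subrr ?normr0//.
  by apply/funext => t; rewrite addn0.
rewrite -[cesaro N u](subrK (cesaro N (fun t => u (t + k)%N))) -addrA.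
rewrite (le_trans (ler_normD _ _))// -natr1 mulrDl lerD// mul1r.
rewrite /cesaro -mulrBr normrM ger0_norm ?invr_ge0// [leRHS]mulrC.
rewrite ler_wpM2l ?invr_ge0// big_ord_recl big_ord_recr/=.
rewrite (eq_bigr (fun i : 'I_N => u (i + k.+1)%N)); last first.
  by move=> i _; rewrite /bump leq0n add1n addSnnS.
rewrite add0n; have := uC k; have := uC (N + k.+1)%N; rewrite !ler_norml.
set A := \sum_(i < N) _; move=> /andP[? ?] /andP[? ?].
by apply/andP; split; lra.
Qed.

End cesaro.

Section cesaro_state.
Context {R : realType} {T : Type} {L : (T -> R) -> Prop}.
Hypothesis AL : function_algebra L.
Implicit Types (f : nat -> T -> R).

Lemma fa_cesaro N f : (forall t, L (f t)) -> L (fun x => cesaro N (f^~ x)).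
Proof.
move=> Lf; apply: (fa_scale AL).
exact: (fa_sum AL _ (f := fun t : 'I_N.+1 => f t)).
Qed.

Lemma st_cesaro (m : (T -> R) -> R) N f : state L m -> (forall t, L (f t)) ->
  m (fun x => cesaro N (f^~ x)) = cesaro N (fun t => m (f t)).
Proof.
move=> Sm Lf; rewrite /cesaro (st_scale Sm).
  by rewrite (st_sum AL Sm _ (f := fun t : 'I_N.+1 => f t)).
exact: (fa_sum AL _ (f := fun t : 'I_N.+1 => f t)).
Qed.

End cesaro_state.

(** * Discrete polynomial averages *)

Fixpoint all_prop (A : Type) (Q : A -> Prop) (s : seq A) : Prop :=
  if s is a :: s' then Q a /\ all_prop Q s' else True.

Lemma all_prop_cat (A : Type) (Q : A -> Prop) s1 s2 :
  all_prop Q s1 -> all_prop Q s2 -> all_prop Q (s1 ++ s2).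
Proof. by elim: s1 => //= a s1 IH [Qa Qs1] Qs2; split=> //; exact: IH. Qed.

Lemma all_prop_map (A B : Type) (Q : A -> Prop) (Q' : B -> Prop) (f : A -> B) s :
  (forall a, Q a -> Q' (f a)) -> all_prop Q s -> all_prop Q' (map f s).
Proof. by move=> QQ'; elim: s => //= a s IH [Qa Qs]; split; [exact: QQ'|exact: IH]. Qed.

Lemma sub_all_prop (A : Type) (Q Q' : A -> Prop) s :
  (forall a, Q a -> Q' a) -> all_prop Q s -> all_prop Q' s.
Proof. by move=> QQ' sQ; rewrite -[s]map_id; exact: all_prop_map sQ. Qed.

Lemma all_prop2 (A : Type) (Q1 Q2 Q : A -> Prop) s :
  (forall a, Q1 a -> Q2 a -> Q a) -> all_prop Q1 s -> all_prop Q2 s ->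
  all_prop Q s.
Proof. by move=> QQ; elim: s => //= a s IH [? ?] [? ?]; split; [exact: QQ|exact: IH]. Qed.

(** * Polynomial sequences in an abelian group *)

Section degree.
Context {V : zmodType}.
Implicit Types h k : nat -> V.

(** Degree is measured by finite differences, which make sense in any abelian group. Constant
    sequences, zero included, have degree at most 0. *)
Fixpoint deg_le (r : nat) h : Prop :=
  if r is r'.+1 then forall m, deg_le r' (fun t => h (m + t)%N - h t)
  else forall t, h t = h 0%N.

Lemma deg_leD r h k : deg_le r h -> deg_le r k -> deg_le r (fun t => h t + k t).
Proof.
elim: r h k => [|r IH] h k /= hr kr; first by move=> t; rewrite hr kr.
move=> m; have := IH _ _ (hr m) (kr m); congr (deg_le r _); apply/funext => t.
by rewrite opprD addrACA.
Qed.

Lemma deg_leN r h : deg_le r h -> deg_le r (fun t => - h t).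
Proof.
elim: r h => [|r IH] h /= hr; first by move=> t; rewrite hr.
by move=> m; have := IH _ (hr m); congr (deg_le r _); apply/funext => t; rewrite opprD.
Qed.

Lemma deg_leB r h k : deg_le r h -> deg_le r k -> deg_le r (fun t => h t - k t).
Proof. by move=> hr kr; apply: deg_leD => //; exact: deg_leN. Qed.

Lemma deg_le0 r : deg_le r (fun=> 0).
Proof.
elim: r => //= r IH m; rewrite [X in deg_le r X](_ : _ = fun=> 0)//.
by apply/funext => t; rewrite subrr.
Qed.

Lemma deg_leS r h : deg_le r h -> deg_le r.+1 h.
Proof.
elim: r h => [|r IH] h hr; last by move=> m; apply: IH; exact: hr.
by move=> m /= t; rewrite !hr.
Qed.

Lemma deg_le_leq r r' h : (r <= r')%N -> deg_le r h -> deg_le r' h.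
Proof.
move=> /subnKC <-; elim: (r' - r)%N => [|i IH]; first by rewrite addn0.
by rewrite addnS => /IH; exact: deg_leS.
Qed.

End degree.
(** All that the discrete argument uses of the measure: [L] stands for the bounded measurable
    functions and [I] for integration. No limit theorem for integrals enters before continuous
    time. *)
Record invariant_state (R : realType) (X : Type) (V : zmodType)
    (tau : V -> X -> X) (L : (X -> R) -> Prop) (I : (X -> R) -> R) : Prop := {
  is_state : state L I ;
  is_bounded : forall f, L f -> exists C, forall x, `|f x| <= C ;
  is_stable : forall v f, L f -> L (fun x => f (tau v x)) ;
  is_invariant : forall v f, L f -> I (fun x => f (tau v x)) = I f ;
  is_act0 : forall x, tau 0 x = x ;
  is_actD : forall u v x, tau (u + v) x = tau u (tau v x) }.

Section systems.
Context {R : realType} {X : Type} {V : zmodType} {tau : V -> X -> X}.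
Context {L : (X -> R) -> Prop} {I : (X -> R) -> R}.
Hypothesis LI : invariant_state tau L I.
Context {U : set_system nat} {UU : UltraFilter U}.
Hypothesis Uoo : \oo `<=` U.

Let SI : state L I := is_state LI.
Let AL : function_algebra L := st_alg SI.

(* A point of [Omega T] is a triple (n, theta, x): n indexes the ultraproduct
   and theta collects the parameters introduced by the reductions so far. *)
Definition Omega (T : Type) := (nat * T * X)%type.

(** * Expectation along the ultrafilter *)

Section one_parameter_space.
Context {T : Type}.
Implicit Types f g : Omega T -> R.

(** Any dependence on [n] and [th] is allowed, because means are states on all functions of the
    parameter. The bound is uniform so that the ultralimit exists. *)
Definition elt f : Prop :=
  (forall n th, L (fun x => f (n, th, x))) /\
  exists C, forall w, `|f w| <= C.

Lemma elt_alg : function_algebra elt.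
Proof.
split.
- by move=> c; split=> [*|]; [exact: (fa_cst AL)|exists `|c|].
- move=> f g [Lf [C fC]] [Lg [D gD]]; split=> [*|]; first exact: (fa_add AL).
  exists (C + D) => w; rewrite (le_trans (ler_normD _ _))//.
  exact: lerD.
- move=> f g [Lf [C fC]] [Lg [D gD]]; split=> [*|]; first exact: (fa_mul AL).
  by exists (C * D) => w; rewrite normrM ler_pM.
Qed.

Definition means (M : nat -> (T -> R) -> R) :=
  forall n, state (fun _ => True) (M n).

Definition mexp (M : nat -> (T -> R) -> R) f : R :=
  ulim (U := U) (fun n => M n (fun th => I (fun x => f (n, th, x)))).

Variable M : nat -> (T -> R) -> R.
Hypothesis HM : means M.

Let SM n := HM n.
Let FT := @function_algebra_full R T.

Lemma slice_norm f C : elt f -> (forall w, `|f w| <= C) -> forall n,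
  `|M n (fun th => I (fun x => f (n, th, x)))| <= C.
Proof.
move=> [Lf _] fC n; apply: (st_norm FT (SM n)) => // th.
exact: (st_norm AL SI).
Qed.

Lemma mexp_bounded f : elt f ->
  bounded_seq (fun n => M n (fun th => I (fun x => f (n, th, x)))).
Proof. by move=> ef; have [_ [C fC]] := ef; exists C; exact: slice_norm. Qed.

Lemma state_mexp : state elt (mexp M).
Proof.
split; first exact: elt_alg.
- move=> f g ef eg; rewrite -ulimD; [|exact: mexp_bounded..].
  congr ulim; apply/funext => n; rewrite -(st_add (SM n))//; congr (M n).
  by apply/funext => th; rewrite (st_add SI)//; [case: ef|case: eg].
- move=> c f ef; rewrite -ulimZ; last exact: mexp_bounded.
  congr ulim; apply/funext => n; rewrite -(st_scale (SM n))//; congr (M n).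
  by apply/funext => th; rewrite (st_scale SI)//; case: ef.
- move=> f ef f0; rewrite -(@ulim_cst R U _ 0); apply: ulim_le.
  + by exists 0 => n; rewrite normr0.
  + exact: mexp_bounded.
  + apply: (@filterE _ U) => n; apply: (st_ge0 (SM n)) => // th.
    by apply: (st_ge0 SI) => //; case: ef.
- rewrite -[RHS](@ulim_cst R U _ 1); congr ulim; apply/funext => n.
  rewrite -[RHS](st_one (SM n)); congr (M n); apply/funext => th.
  exact: (st_one SI).
Qed.

(** Integrals over [x] are compared rather than values, since invariance of [I] gives no pointwise
    information. *)
Lemma mexp_slice_le f g : elt f -> elt g ->
  (forall n th, I (fun x => f (n, th, x)) <= I (fun x => g (n, th, x))) ->
  mexp M f <= mexp M g.
Proof.
move=> ef eg fg; apply: ulim_le; [exact: mexp_bounded..|].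
by apply: (@filterE _ U) => n; exact: (st_le FT (SM n)).
Qed.

Lemma eq_mexp_slice f g :
  (forall n th, I (fun x => f (n, th, x)) = I (fun x => g (n, th, x))) ->
  mexp M f = mexp M g.
Proof.
move=> fg; congr ulim; apply/funext => n; congr (M n).
by apply/funext => th.
Qed.

(** This discards errors that are small only for large [n]. *)
Lemma mexp_near_le f c : elt f ->
  (\forall n \near U, forall th x, f (n, th, x) <= c) -> mexp M f <= c.
Proof.
move=> ef fc; rewrite -[leRHS](@ulim_cst R U _ c); apply: ulim_le.
- exact: mexp_bounded.
- by exists `|c|.
- apply: filterS fc => n fc; apply: (st_le_cst FT (SM n)) => // th.
  by apply: (st_le_cst AL SI) => [|x]; [case: ef|exact: fc].
Qed.

Definition act (a : T -> V) f : Omega T -> R :=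
  fun w => f (w.1, tau (a w.1.2) w.2).

Lemma elt_act a f : elt f -> elt (act a f).
Proof.
by move=> [Lf [C fC]]; split=> [n th|]; [exact: (is_stable LI (a th) (Lf n th))|exists C => w; exact: fC].
Qed.

Definition cauchy2 (a : nat -> Omega T -> R) := forall e : R, 0 < e ->
  exists N0, forall N N', (N0 <= N)%N -> (N0 <= N')%N ->
    mexp M (fun w => (a N w - a N' w) ^+ 2) <= e.

Lemma eq_mexp f g : f =1 g -> mexp M f = mexp M g.
Proof. by move=> /funext ->. Qed.

Lemma mexp_sqrD f g : elt f -> elt g ->
  mexp M (fun w => (f w + g w) ^+ 2) <=
  2 * mexp M (fun w => f w ^+ 2) + 2 * mexp M (fun w => g w ^+ 2).
Proof.
move=> ef eg; have ef2 := fa_sqr elt_alg ef; have eg2 := fa_sqr elt_alg eg.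
rewrite -!(st_scale state_mexp)// -(st_add state_mexp); last 2 first.
- exact: (fa_scale elt_alg).
- exact: (fa_scale elt_alg).
apply: (st_le elt_alg state_mexp).
- by apply: (fa_sqr elt_alg); exact: (fa_add elt_alg).
- by apply: (fa_add elt_alg); exact: (fa_scale elt_alg).
- by move=> w; have := sqr_ge0 (f w - g w); nra.
Qed.

End one_parameter_space.
Arguments cauchy2 {T}.

(** * One reduction: [c] moves the chosen factor, [P] is the product of the others *)

Section reduction.
Context {T : Type} {M : nat -> (T -> R) -> R} (HM : means M).
Variables (c : T -> nat -> V) (P : nat -> Omega T -> R) (K : R).
Hypotheses (K0 : 0 <= K) (PK : forall t w, `|P t w| <= K).
Hypothesis eP : forall t, elt (P t).
Implicit Types u b : Omega T -> R.

Let AE : function_algebra (@elt T) := elt_alg.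

Definition wavg u N w := cesaro N (fun t => act (c^~ t) u w * P t w).

Lemma elt_wavg u N : elt u -> elt (wavg u N).
Proof.
by move=> eu; apply: (fa_cesaro AE) => t; apply: (fa_mul AE) => //; exact: elt_act.
Qed.

Lemma wavgD u v N w : wavg (fun w => u w + v w) N w = wavg u N w + wavg v N w.
Proof.
by rewrite -cesaroD; congr (cesaro N); apply/funext => t; rewrite -mulrDl.
Qed.

Lemma wavgZ a u N w : wavg (fun w => a * u w) N w = a * wavg u N w.
Proof.
by rewrite -cesaroZ; congr (cesaro N); apply/funext => t; rewrite mulrA.
Qed.

Let sqr_leK t w a : (a * P t w) ^+ 2 <= K ^+ 2 * a ^+ 2.
Proof.
rewrite exprMn mulrC ler_wpM2r ?sqr_ge0//.
by rewrite -[leLHS]real_normK ?num_real// lerXn2r ?nnegrE.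
Qed.

(** Jensen over [t], the bound [K] on [P], and invariance under each [c th t]. *)
Lemma slice_wavg_sqr u N n th : elt u ->
  I (fun x => wavg u N (n, th, x) ^+ 2) <= K ^+ 2 * I (fun x => u (n, th, x) ^+ 2).
Proof.
move=> eu; have [Lu _] := eu.
have LP t : L (fun x => act (c^~ t) u (n, th, x) ^+ 2).
  exact: (fa_sqr elt_alg (elt_act _ eu)).1.
apply: (@le_trans _ _ (I (fun x => cesaro N (fun t =>
    K ^+ 2 * act (c^~ t) u (n, th, x) ^+ 2)))).
  apply: (st_le AL SI).
  - exact: (fa_sqr elt_alg (elt_wavg N eu)).1.
  - by apply: (fa_cesaro AL) => t; exact: (fa_scale AL).
  - move=> x; rewrite (le_trans (cesaro_sqr _ _))//; apply: cesaro_le => t _.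
    exact: sqr_leK.
rewrite (st_cesaro AL _ SI (f := fun t x => K ^+ 2 * act (c^~ t) u (n, th, x) ^+ 2)).
  rewrite -[leRHS](cesaro_cst N); apply: cesaro_le => t _.
  rewrite (st_scale SI)// ler_wpM2l ?sqr_ge0//.
  have L2 := fa_sqr AL (Lu n th).
  by rewrite -(is_invariant LI (c th t) L2).
by move=> t; exact: (fa_scale AL).
Qed.

(** The adjoint of the operator [wavg] of length [N n], applied to [b]. The length may vary with the
    ultraproduct index. *)
Definition reducible (N : nat -> nat) b : Omega T -> R := fun w =>
  cesaro (N w.1.1) (fun m => act (fun th => - c th m) (fun w => b w * P m w) w).

Lemma elt_reducible N b : elt b -> elt (reducible N b).
Proof.
move=> eb; have ebP m : elt (act (fun th => - c th m) (fun w => b w * P m w)).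
  exact/elt_act/(fa_mul AE).
split=> [n th|].
  apply: (fa_cesaro AL (N n) (f := fun m x => act (fun th => - c th m)
    (fun w => b w * P m w) (n, th, x))) => m.
  exact: (ebP m).1.
have [_ [C bC]] := eb; exists (C * K) => w; apply: cesaro_norm => m _.
by rewrite normrM ler_pM.
Qed.

Lemma slice_reducible_sqr N b n th : elt b ->
  I (fun x => reducible N b (n, th, x) ^+ 2) <=
  K ^+ 2 * I (fun x => b (n, th, x) ^+ 2).
Proof.
move=> eb; have [Lb _] := eb.
have eb2 m : elt (act (fun th => - c th m) (fun w => K ^+ 2 * b w ^+ 2)).
  by apply: elt_act; apply: (fa_scale AE); exact: (fa_sqr AE).
apply: (@le_trans _ _ (I (fun x => cesaro (N n) (fun m =>
    act (fun th => - c th m) (fun w => K ^+ 2 * b w ^+ 2) (n, th, x))))).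
  apply: (st_le AL SI).
  - exact: (fa_sqr elt_alg (elt_reducible N eb)).1.
  - apply: (fa_cesaro AL _ (f := fun m x => act (fun th => - c th m)
      (fun w => K ^+ 2 * b w ^+ 2) (n, th, x))) => m.
    exact: (eb2 m).1.
  - move=> x; rewrite (le_trans (cesaro_sqr _ _))//; apply: cesaro_le => t _.
    exact: sqr_leK.
rewrite (st_cesaro AL _ SI (f := fun m x => act (fun th => - c th m)
    (fun w => K ^+ 2 * b w ^+ 2) (n, th, x))); last first.
  by move=> m; exact: (eb2 m).1.
rewrite -[leRHS](cesaro_cst (N n)); apply: cesaro_le => t _.
have L2 := fa_sqr AL (Lb n th); have L2K := fa_scale AL (K ^+ 2) L2.
by rewrite -(st_scale SI)// -(is_invariant LI (- c th t) L2K).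
Qed.

Lemma tauKV v x : tau (- v) (tau v x) = x.
Proof. by rewrite -(is_actD LI) addNr (is_act0 LI). Qed.

(** Adjointness: in the [m]-th term, substituting [tau (c th m) x] for [x] moves the translation
    from [b * P m] to [u]. *)
Lemma slice_reducible_inner N u n th : elt u ->
  let b := fun w => wavg u (N w.1.1) w in elt b ->
  I (fun x => u (n, th, x) * reducible N b (n, th, x)) =
  I (fun x => b (n, th, x) ^+ 2).
Proof.
move=> eu b eb; have [Lu _] := eu; have [Lb _] := eb.
have ebP m : elt (act (fun th => - c th m) (fun w => b w * P m w)).
  exact/elt_act/(fa_mul AE).
have euP m : elt (fun w => act (c^~ m) u w * P m w).
  by apply: (fa_mul AE) => //; exact: elt_act.
transitivity (I (fun x => cesaro (N n) (fun m => u (n, th, x) *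
    act (fun th => - c th m) (fun w => b w * P m w) (n, th, x)))).
  by congr I; apply/funext => x; rewrite cesaroZ.
rewrite (st_cesaro AL _ SI (f := fun m x => u (n, th, x) *
    act (fun th => - c th m) (fun w => b w * P m w) (n, th, x))); last first.
  by move=> m; apply: (fa_mul AL) => //; exact: (ebP m).1.
transitivity (I (fun x => cesaro (N n) (fun m => b (n, th, x) *
    (act (c^~ m) u (n, th, x) * P m (n, th, x))))); last first.
  by congr I; apply/funext => x; rewrite cesaroZ.
rewrite (st_cesaro AL _ SI (f := fun m x => b (n, th, x) *
    (act (c^~ m) u (n, th, x) * P m (n, th, x)))); last first.
  by move=> m; apply: (fa_mul AL) => //; exact: (euP m).1.
congr (cesaro _ _); apply/funext => m.
rewrite -(is_invariant LI (c th m)); last first.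
  by apply: (fa_mul AL) => //; exact: (ebP m).1.
congr I; apply/funext => x; rewrite /act/= tauKV; ring.
Qed.


Definition prod_means (N : nat -> nat) n (phi : T * nat -> R) : R :=
  M n (fun th => cesaro (N n) (fun m => phi (th, m))).

Lemma means_prod N : means (prod_means N).
Proof.
move=> n; have FT := @function_algebra_full R T; split=> //.
- move=> f g _ _; rewrite -(st_add (HM n))//; congr (M n).
  by apply/funext => th; rewrite cesaroD.
- move=> a f _; rewrite -(st_scale (HM n))//; congr (M n).
  by apply/funext => th; rewrite cesaroZ.
- move=> f _ f0; apply: (st_ge0 (HM n)) => // th.
  exact: (st_ge0 (state_cesaro _)).
- rewrite -[RHS](st_one (HM n)); congr (M n).
  by apply/funext => th; rewrite cesaro_cst.
Qed.

(* The average obtained from [wavg (reducible N b)] after the shift of [m] by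
   [t], with [m] kept as a new parameter. *)
Definition reduced_avg b N (w : Omega (T * nat)) : R :=
  let w' := (w.1.1, w.1.2.1, w.2) in let m := w.1.2.2 in
  cesaro N (fun t => P t w' * act (fun th => c th t - c th (m + t)%N)
    (fun v => b v * P (m + t)%N v) w').

Lemma elt_reduced_avg b N : elt b -> elt (reduced_avg b N).
Proof.
move=> eb; have [_ [C bC]] := eb; split=> [n [th m]|].
  apply: (fa_cesaro AL N (f := fun t x => P t (n, th, x) *
    act (fun th => c th t - c th (m + t)%N)
    (fun v => b v * P (m + t)%N v) (n, th, x))) => t.
  apply: (fa_mul AL); first exact: (eP t).1.
  exact: ((elt_act (fun th => c th t - c th (m + t)%N)
    (fa_mul AE eb (eP (m + t)%N))).1 n th).
exists (K * (C * K)) => w; apply: cesaro_norm => t _.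
rewrite normrM ler_pM// normrM ler_pM//; exact: PK.
Qed.

(** After exchanging the averages, replacing [m] by [m + t] is a shift by [t <= N'], priced by
    [cesaro_shift]. The last factor [K] bounds [P t]. *)
Lemma wavg_reducible_near N b C N' w : (forall v, `|b v| <= C) ->
  `|wavg (reducible N b) N' w -
    cesaro (N w.1.1) (fun m => reduced_avg b N' (w.1.1, (w.1.2, m), w.2))| <=
  N'%:R * (2 * (C * K) / (N w.1.1).+1%:R) * K.
Proof.
move=> bC; rewrite exchange_cesaro -cesaroB; apply: cesaro_norm => t tN.
pose psi m := (fun v => b v * P m v) (w.1, tau (c w.1.2 t - c w.1.2 m) w.2).
rewrite [X in `|X|](_ : _ = (cesaro (N w.1.1) psi -
    cesaro (N w.1.1) (fun m => psi (m + t)%N)) * P t w); last first.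
  rewrite mulrBl; congr (_ * _ - _).
    congr (cesaro _ _); apply/funext => m.
    by rewrite /psi /act/= -(is_actD LI) [X in tau X]addrC.
  rewrite mulrC -cesaroZ; congr (cesaro _ _); apply/funext => m.
  by case: w @psi => [[]].
have psiC m : `|psi m| <= C * K by rewrite normrM ler_pM.
rewrite normrM ler_pM// (le_trans (cesaro_shift _ _ psiC))//.
rewrite ler_wpM2r ?ler_nat// mulr_ge0 ?invr_ge0// mulr_ge0//.
by rewrite (le_trans (normr_ge0 _) (psiC 0%N)).
Qed.

(** Jensen in [m]: averaging out the new parameter does not increase the norm. *)
Lemma mexp_cesaro_le N (f : Omega (T * nat) -> R) : elt f ->
  mexp M (fun w => cesaro (N w.1.1) (fun m => f (w.1.1, (w.1.2, m), w.2)) ^+ 2)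
  <= mexp (prod_means N) (fun w => f w ^+ 2).
Proof.
move=> ef; have [Lf [C fC]] := ef.
have ef2 := fa_sqr elt_alg ef.
have ecf : elt (fun w : Omega T =>
    cesaro (N w.1.1) (fun m => f (w.1.1, (w.1.2, m), w.2))).
  split=> [n th|]; last by exists C => w; exact: cesaro_norm.
  exact: (fa_cesaro AL (N n) (f := fun m x => f (n, (th, m), x))).
apply: ulim_le.
- exact: (mexp_bounded HM (fa_sqr elt_alg ecf)).
- exact: (mexp_bounded (means_prod N) ef2).
- apply: (@filterE _ U) => n.
  apply: (st_le (function_algebra_full T) (HM n)) => // th.
  rewrite -(st_cesaro AL (N n) SI (f := fun m x => f (n, (th, m), x) ^+ 2)).
    apply: (st_le AL SI) => [||x]; last exact: cesaro_sqr.
      exact: (fa_sqr AL (ecf.1 n th)).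
    apply: (fa_cesaro AL (N n) (f := fun m x => f (n, (th, m), x) ^+ 2)) => m.
    exact: (ef2.1 n (th, m)).
  by move=> m; exact: (ef2.1 n (th, m)).
Qed.

Definition tends_to_oo (N : nat -> nat) :=
  forall k, \forall n \near U, (k <= N n)%N.

(** Up to an error [D], the averages are the means [G] over [m] of the reduced averages. For fixed
    lengths [N1] and [N2] the error is of order [(N1 + N2) / N n], and the limit in [n] is taken
    first. *)
Lemma cauchy_wavg_reducible N b : tends_to_oo N -> elt b ->
  cauchy2 (prod_means N) (reduced_avg b) -> cauchy2 M (wavg (reducible N b)).
Proof.
move=> Noo eb H e e0.
have e40 : 0 < e / 4 by rewrite divr_gt0.
have [N0 {}H] := H _ e40; exists N0 => N1 N2 N01 N02.
have [_ [C bC]] := eb.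
(* The sign of [C] is read off at a point, as [Omega T] may be empty. *)
have C0 (w0 : Omega T) : 0 <= C := le_trans (normr_ge0 _) (bC w0).
pose ra N' := fun w => reduced_avg b N' w.
pose G N' w := cesaro (N w.1.1) (fun m => ra N' (w.1.1, (w.1.2, m), w.2)).
pose D N' w := wavg (reducible N b) N' w - G N' w.
have era N' : elt (ra N') by exact: elt_reduced_avg.
have eG N' : elt (G N').
  have [Lf [C' fC]] := era N'; split=> [n th|]; last first.
    by exists C' => w; exact: cesaro_norm.
  exact: (fa_cesaro AL (N n) (f := fun m x => ra N' (n, (th, m), x))).
have eD N' : elt (D N').
  by apply: (fa_sub AE) => //; apply: elt_wavg; exact: elt_reducible.
rewrite (@eq_mexp _ _ _ (fun w => ((G N1 w - G N2 w) + (D N1 w - D N2 w)) ^+ 2));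
  last by move=> w; rewrite /D; congr (_ ^+ 2); ring.
apply: (le_trans (mexp_sqrD HM (fa_sub AE (eG N1) (eG N2))
                               (fa_sub AE (eD N1) (eD N2)))).
have GG : mexp M (fun w => (G N1 w - G N2 w) ^+ 2) <= e / 4.
  apply: le_trans (H N1 N2 N01 N02).
  apply: le_trans (mexp_cesaro_le N (fa_sub elt_alg (era N1) (era N2))).
  apply: (st_le AE (state_mexp HM)).
  - exact: (fa_sqr AE (fa_sub AE (eG N1) (eG N2))).
  - apply: (fa_sqr AE); have := fa_sub AE (eG N1) (eG N2).
    rewrite [X in elt X -> _](_ : _ = (fun w => cesaro (N w.1.1)
      (fun m => ra N1 (w.1.1, (w.1.2, m), w.2) -
                ra N2 (w.1.1, (w.1.2, m), w.2))))//.
    by apply/funext => w; rewrite cesaroB.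
  - by move=> w; rewrite cesaroB.
have DD : mexp M (fun w => (D N1 w - D N2 w) ^+ 2) <= e / 4.
  apply: (mexp_near_le HM); first exact: (fa_sqr AE (fa_sub AE (eD N1) (eD N2))).
  (* As [k <= 1], an absolute value at most [k] has square at most [k <= e / 4]. *)
  pose k : R := Num.min 1 (e / 4).
  have k0 : 0 < k by rewrite lt_min ltr01.
  have k1 : k <= 1 by rewrite ge_min lexx.
  have ke : k <= e / 4 by rewrite ge_min lexx orbT.
  pose A := (N1 + N2)%:R * (2 * (C * K)) * K.
  apply: filterS (Noo (Num.bound (A / k))) => n nA th x.
  have A0 : 0 <= A by rewrite !mulr_ge0// (C0 (n, th, x)).
  have n1 : 0 < (N n).+1%:R :> R by rewrite ltr0n.
  have DA : `|D N1 (n, th, x) - D N2 (n, th, x)| <= A / (N n).+1%:R.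
    rewrite (le_trans (ler_normB _ _))//.
    have h N' := @wavg_reducible_near N b C N' (n, th, x) bC.
    apply: (le_trans (lerD (h N1) (h N2))); rewrite /A natrD.
    by rewrite le_eqVlt; apply/orP; left; apply/eqP; rewrite /=; ring.
  have An : A / (N n).+1%:R <= k.
    rewrite ler_pdivrMr// mulrC -ler_pdivrMr// ltW//.
    rewrite (lt_le_trans (archi_boundP _)) ?divr_ge0 ?(ltW k0)// ler_nat.
    exact: leqW.
  rewrite -[leLHS]real_normK ?num_real//; set y := `|_| in DA *.
  have y0 : 0 <= y by rewrite /y.
  have yk := le_trans DA An.
  by rewrite (le_trans _ ke)// expr2 -[leRHS]mulr1 ler_pM// (le_trans yk).
clear - GG DD; set p := mexp M _ in GG *; set q := mexp M _ in DD *; lra.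
Qed.

Lemma cauchy_wavg_lin z s a : elt z -> elt s -> cauchy2 M (wavg z) ->
  cauchy2 M (wavg s) -> cauchy2 M (wavg (fun w => z w + a * s w)).
Proof.
move=> ez es Cz Cs e e0.
have e40 : 0 < e / 4 by rewrite divr_gt0.
(* The summand 1 keeps the divisor positive when [a = 0]. *)
have a1 : 0 < 4 * (a ^+ 2 + 1) by rewrite mulr_gt0// ltr_wpDl// sqr_ge0.
have ea0 : 0 < e / (4 * (a ^+ 2 + 1)) by rewrite divr_gt0.
have [N1 Hz] := Cz _ e40; have [N2 Hs] := Cs _ ea0.
exists (maxn N1 N2) => N N'; rewrite !geq_max => /andP[n1 n2] /andP[n1' n2'].
have edz := fa_sub AE (elt_wavg N ez) (elt_wavg N' ez).
have eds := fa_sub AE (elt_wavg N es) (elt_wavg N' es).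
rewrite (@eq_mexp _ _ _ (fun w => ((wavg z N w - wavg z N' w) +
  a * (wavg s N w - wavg s N' w)) ^+ 2)); last first.
  by move=> w; rewrite !wavgD !wavgZ; congr (_ ^+ 2); ring.
apply: (le_trans (mexp_sqrD HM edz (fa_scale AE a eds))).
rewrite [X in _ + 2 * X](_ : _ =
    a ^+ 2 * mexp M (fun w => (wavg s N w - wavg s N' w) ^+ 2)); last first.
  rewrite -(st_scale (state_mexp HM)); last exact: (fa_sqr AE).
  by apply: eq_mexp => w; rewrite exprMn.
have {}Hz := Hz _ _ n1 n1'; have := Hs _ _ n2 n2'; rewrite ler_pdivlMr//; move: Hz.
have : 0 <= mexp M (fun w => (wavg s N w - wavg s N' w) ^+ 2).
  by apply: (st_ge0 (state_mexp HM)) => [|w]; [exact: (fa_sqr AE)|exact: sqr_ge0].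
set p := mexp M _; set q := mexp M _.
clear; move: (a ^+ 2) p q => a2 p q ? ? ?; nra.
Qed.

(* Near-minimality of [z] bounds the inner product of [u = g - z] with the
   reducible function [s], since all [z + lam * s] compete with [z]. *)
Lemma cauchy_wavg_reduction :
  (forall N b, tends_to_oo N -> elt b ->
    cauchy2 (prod_means N) (reduced_avg b)) ->
  forall u, elt u -> cauchy2 M (wavg u).
Proof.
move=> Hred g eg e e0.
have SE := state_mexp HM.
have sq_ge0 f : elt f -> 0 <= mexp M (fun w => f w ^+ 2).
  by move=> ef; apply: (st_ge0 SE) => [|w]; [exact: (fa_sqr AE)|exact: sqr_ge0].
(* [Z] is the subspace of functions with Cauchy averages, and [d] below is the squared distance from
   [g] to it. *)
pose Z z := elt z /\ cauchy2 M (wavg z).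
pose S : set R := [set mexp M (fun w => (g w - z w) ^+ 2) | z in Z].
have Z0 : Z (fun=> 0).
  split=> [|a a0]; first exact: (fa_cst AE).
  exists 0%N => N N' _ _; rewrite (@eq_mexp _ _ _ (fun=> 0)).
    by rewrite (st_cst AE SE) ltW.
  move=> w; rewrite -[fun=> 0](_ : (fun _ => 0 * g w) = _).
    by rewrite !wavgZ !mul0r subrr expr0n.
  by apply/funext => ?; rewrite mul0r.
have infS : has_inf S.
  split; first by exists (mexp M (fun w => (g w - 0) ^+ 2)); exists (fun=> 0).
  by exists 0 => _ [z [ez _] <-]; apply: sq_ge0; exact: (fa_sub AE).
pose d := inf S.
have d0 : 0 <= d.
  by apply: lb_le_inf infS.1 _ => _ [z [ez _] <-]; apply: sq_ge0; exact: (fa_sub AE).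
(* [K1] bounds the squared norm of [s]: the two averaging operators contribute [K ^+ 2] each, and
   the squared norm of [u] is at most [d + 1]. *)
pose K1 := (K ^+ 2) * (K ^+ 2 * (d + 1)).
have K10 : 0 <= K1 by rewrite !mulr_ge0 ?sqr_ge0// addr_ge0.
(* The two uses of [mexp_sqrD] give [2 * (e / 4) + 2 * (2 * eta + 2 * eta) = e]. *)
pose eta := e / 16.
have eta0 : 0 < eta by rewrite divr_gt0.
(* This makes [lam ^+ 2 * K1 <= lam * eta / 4]. Moving [z] by [lam * s] then lowers the squared
   distance by at least [3 / 4 * lam * eta], more than the slack [del <= lam * eta / 4]. *)
pose lam := eta / 2 / (2 * (K1 + 1)).
have lam0 : 0 < lam by rewrite !divr_gt0// mulr_gt0// ltr_wpDl.
pose del : R := Num.min 1 (lam * (eta / 2) / 2).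
have del0 : 0 < del by rewrite lt_min ltr01/= divr_gt0// mulr_gt0// divr_gt0.
have [_ [z Zz <-] gz] := inf_adherent del0 infS.
have [ez Cz] := Zz; pose u w := g w - z w.
have eu : elt u by exact: (fa_sub AE).
have uE N w : wavg g N w = wavg z N w + wavg u N w.
  rewrite -wavgD; congr (wavg _ N w); apply/funext => v.
  by rewrite /u addrC subrK.
suff [N1 HN1] : exists N1, forall N, (N1 <= N)%N ->
    mexp M (fun w => wavg u N w ^+ 2) <= eta.
  have e40 : 0 < e / 4 by rewrite divr_gt0.
  have [N2 HN2] := Cz _ e40.
  exists (maxn N1 N2) => N N'; rewrite !geq_max => /andP[n1 n2] /andP[n1' n2'].
  have edz := fa_sub AE (elt_wavg N ez) (elt_wavg N' ez).
  have edu := fa_sub AE (elt_wavg N eu) (elt_wavg N' eu).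
  rewrite (@eq_mexp _ _ _ (fun w => ((wavg z N w - wavg z N' w) +
    (wavg u N w - wavg u N' w)) ^+ 2)); last first.
    by move=> w; rewrite !uE; congr (_ ^+ 2); ring.
  apply: (le_trans (mexp_sqrD HM edz edu)).
  have {}HN2 := HN2 _ _ n2 n2'.
  have := mexp_sqrD HM (elt_wavg N eu) (fa_scale AE (-1) (elt_wavg N' eu)).
  rewrite (@eq_mexp _ _ _ (fun w => (wavg u N w - wavg u N' w) ^+ 2)); last first.
    by move=> w; rewrite mulN1r.
  rewrite [X in _ + _ * X](@eq_mexp _ _ _ (fun w => wavg u N' w ^+ 2)); last first.
    by move=> w; rewrite mulN1r sqrrN.
  move: HN2 (HN1 _ n1) (HN1 _ n1').
  set p1 := mexp M _; set p2 := mexp M _; set p3 := mexp M _; set p4 := mexp M _.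
  rewrite /eta; move: p1 p2 p3 p4 => p1 p2 p3 p4 *; lra.
apply: contrapT => noN1.
have often k : exists2 N, (k <= N)%N & eta < mexp M (fun w => wavg u N w ^+ 2).
  apply: contrapT => H; apply: noN1; exists k => N kN.
  by rewrite leNgt; apply/negP => uN; apply: H; exists N.
pose val n N := M n (fun th => I (fun x => wavg u N (n, th, x) ^+ 2)).
(* The largest length up to [n] whose average is still big at index [n], or 0 if there is none. Each
   length with expectation above [eta] qualifies for [U]-almost all [n], and such lengths are
   unbounded, so [Nn] tends to infinity along [U]. *)
pose Nn n := (\max_(j < n.+1 | (eta / 2 < val n j)%R) j)%N.
have Nn_large k : \forall n \near U, (k <= Nn n)%N /\ eta / 2 < val n (Nn n).
  have [N kN uN] := often k.
  have near1 : \forall n \near U, eta / 2 < val n N.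
    apply: (ulim_near_gt (mexp_bounded HM (fa_sqr AE (elt_wavg N eu)))).
    by rewrite (lt_trans _ uN)// ltr_pdivrMr// ltr_pMr// ltr1n.
  have near2 : \forall n \near U, (N <= n)%N by apply: Uoo; exact: nbhs_infty_ge.
  apply: filterS2 near1 near2 => n vn Nn'.
  have Nlt : (N < n.+1)%N by [].
  split; first by rewrite (leq_trans kN)// (@leq_bigmax_cond _ _ _ (Ordinal Nlt)).
  have [|j vj jE] := @eq_bigmax_cond _ [pred j : 'I_n.+1 | eta / 2 < val n j]
    (fun j : 'I_n.+1 => j : nat).
    by apply/card_gt0P; exists (Ordinal Nlt); rewrite inE.
  suff -> : Nn n = j by [].
  by apply: etrans jE; apply: eq_bigl => i; rewrite inE.
have Nnoo : tends_to_oo Nn by move=> k; apply: filterS (Nn_large k) => n [].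
pose b w := wavg u (Nn w.1.1) w.
have [_ [C uC]] := eu.
have eb : elt b.
  split=> [n th|]; first exact: (elt_wavg (Nn n) eu).1.
  by exists (C * K) => w; apply: cesaro_norm => t _; rewrite /act normrM ler_pM.
pose s := reducible Nn b.
have es : elt s by exact: elt_reducible.
have Cs : cauchy2 M (wavg s) by apply: cauchy_wavg_reducible => //; exact: Hred.
have inner : eta / 2 <= mexp M (fun w => u w * s w).
  rewrite (@eq_mexp_slice _ _ _ (fun w => b w ^+ 2)); last first.
    by move=> n th; exact: slice_reducible_inner.
  apply: ulim_ge; first exact: (mexp_bounded HM (fa_sqr AE eb)).
  by apply: filterS (Nn_large 0%N) => n [_ /ltW].
have del1 : del <= 1 by rewrite ge_min lexx.
have del2 : del <= lam * (eta / 2) / 2 by rewrite ge_min lexx orbT.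
have uu : mexp M (fun w => u w ^+ 2) <= d + del by exact: ltW.
have bb : mexp M (fun w => b w ^+ 2) <= K ^+ 2 * mexp M (fun w => u w ^+ 2).
  rewrite -(st_scale SE); last exact: (fa_sqr AE).
  apply: (mexp_slice_le HM).
  - exact: (fa_sqr AE).
  - by apply: (fa_scale AE); exact: (fa_sqr AE).
  move=> n th; rewrite (st_scale SI); first exact: (slice_wavg_sqr (Nn n) n th eu).
  exact: ((fa_sqr AE eu).1 n th).
have ss : mexp M (fun w => s w ^+ 2) <= K1.
  apply: (@le_trans _ _ (K ^+ 2 * mexp M (fun w => b w ^+ 2))).
    rewrite -(st_scale SE); last exact: (fa_sqr AE).
    apply: (mexp_slice_le HM).
    - exact: (fa_sqr AE).
    - by apply: (fa_scale AE); exact: (fa_sqr AE).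
    move=> n th; rewrite (st_scale SI); first exact: (slice_reducible_sqr Nn n th eb).
    exact: ((fa_sqr AE eb).1 n th).
  rewrite ler_wpM2l ?sqr_ge0// (le_trans bb)// ler_wpM2l ?sqr_ge0//.
  by rewrite (le_trans uu)// lerD2l.
have : d <= mexp M (fun w => (g w - (z w + lam * s w)) ^+ 2).
  apply: (ge_inf infS.2); exists (fun w => z w + lam * s w) => //; split.
    by apply: (fa_add AE) => //; exact: (fa_scale AE).
  exact: cauchy_wavg_lin.
rewrite (@eq_mexp _ _ _ (fun w => u w ^+ 2 +
    ((- 2 * lam) * (u w * s w) + lam ^+ 2 * s w ^+ 2))); last first.
  by move=> w; rewrite /u; ring.
have eus := fa_mul AE eu es.
have eus' := fa_scale AE (- 2 * lam) eus.
have es2 := fa_sqr AE es.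
have es2' := fa_scale AE (lam ^+ 2) es2.
rewrite (st_add SE (fa_sqr AE eu) (fa_add AE eus' es2')) (st_add SE eus' es2').
rewrite (st_scale SE _ eus) (st_scale SE _ es2).
have lamE : lam * (2 * (K1 + 1)) = eta / 2.
  by rewrite /lam divfK// lt0r_neq0// mulr_gt0// ltr_wpDl.
have : lam ^+ 2 * mexp M (fun w => s w ^+ 2) <= lam ^+ 2 * K1.
  by rewrite ler_wpM2l ?sqr_ge0.
have : lam * (eta / 2) <= lam * mexp M (fun w => u w * s w).
  by rewrite ler_wpM2l// ltW.
have l2 : 0 < lam * eta by rewrite mulr_gt0.
have lam2E : lam ^+ 2 * K1 <= lam * eta / 4.
  rewrite (_ : lam * eta / 4 = lam * (lam * (2 * (K1 + 1)) / 2)).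
    by rewrite -subr_ge0 (_ : _ - _ = lam ^+ 2);
      [exact: sqr_ge0|field].
  by rewrite lamE; field.
move: uu del2 lam2E l2 d0.
set p1 := mexp M _; set p2 := mexp M _; set p3 := mexp M _.
set l3 := lam ^+ 2 * p3; set l4 := lam ^+ 2 * K1.
set l5 := lam * p2; rewrite (_ : - 2 * lam * p2 = - 2 * l5); last by rewrite /l5; ring.
rewrite (_ : lam * (eta / 2) = lam * eta / 2); last by field.
move: l3 l4 l5 p1 (lam * eta) => l3 l4 l5 p1 le.
by move=> *; lra.
Qed.
End reduction.

(** * Covers of sequences by balls, and the induction *)

Section covers.
Implicit Types T : Type.

Definition poly_family T := T -> nat -> V.

(** For each [r] this is an equivalence relation, as in an ultrametric space: [dist_le_trans] loses
    no radius. *)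
Definition dist_le T (r : nat) (p q : poly_family T) :=
  forall th, deg_le r (fun t => p th t - q th t).

Lemma dist_le_refl T r (p : poly_family T) : dist_le r p p.
Proof.
move=> th; rewrite [X in deg_le r X](_ : _ = fun=> 0); first exact: deg_le0.
by apply/funext => t; rewrite subrr.
Qed.

Lemma dist_le_sym T r (p q : poly_family T) : dist_le r p q -> dist_le r q p.
Proof.
move=> pq th; have := deg_leN (pq th); congr (deg_le r _); apply/funext => t.
by rewrite opprB.
Qed.

Lemma dist_le_trans T r (p q s : poly_family T) :
  dist_le r p q -> dist_le r q s -> dist_le r p s.
Proof.
move=> pq qs th; have := deg_leD (pq th) (qs th); congr (deg_le r _).
by apply/funext => t; rewrite addrA subrK.
Qed.

Lemma dist_le_leq T r r' (p q : poly_family T) :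
  (r <= r')%N -> dist_le r p q -> dist_le r' p q.
Proof. by move=> rr' pq th; exact: deg_le_leq (pq th). Qed.

(* A pair (c, r) stands for the ball of center c and radius r. *)
Fixpoint covered T (S : seq (poly_family T * nat)) (p : poly_family T) : Prop :=
  if S is b :: S' then dist_le b.2 p b.1 \/ covered S' p else False.

Lemma covered_cat T (S1 S2 : seq (poly_family T * nat)) p :
  covered S1 p \/ covered S2 p -> covered (S1 ++ S2) p.
Proof.
elim: S1 => [[]//|b S1 IH] /= [[|S1p]|S2p]; [by left|right|right].
  by apply: IH; left.
by apply: IH; right.
Qed.

Definition pull T T' (pi : T' -> T) (S : seq (poly_family T * nat)) :=
  [seq ((fun th => b.1 (pi th)) : poly_family T', b.2) | b <- S].

Lemma covered_pull T T' (pi : T' -> T) S p :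
  covered S p -> covered (pull pi S) (fun th => p (pi th)).
Proof. by elim: S => //= b S IH [pb|/IH]; [left=> th|right]. Qed.

Lemma pull_comp T T' T'' (pi : T' -> T) (pi' : T'' -> T') S :
  pull pi' (pull pi S) = pull (pi \o pi') S.
Proof. by rewrite /pull -map_comp. Qed.

Definition system T := seq (poly_family T * (Omega T -> R)).

Definition system_prod T (s : system T) t (w : Omega T) : R :=
  \prod_(q <- s) act (q.1^~ t) q.2 w.

Definition system_avg T (s : system T) N (w : Omega T) : R :=
  cesaro N (fun t => system_prod s t w).

Definition in_cover T (S : seq (poly_family T * nat)) (s : system T) :=
  all_prop (fun q => elt q.2 /\ covered S q.1) s.

(** Goodness ranges over all parameter spaces above [T], so that it still applies after a reduction
    has added the parameter [m]. *)
Definition good T (S : seq (poly_family T * nat)) :=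
  forall T' (pi : T' -> T) (M : nat -> (T' -> R) -> R), means M ->
  forall s, in_cover (pull pi S) s -> cauchy2 M (system_avg s).

Lemma good_pull T T' (pi : T' -> T) S : good S -> good (pull pi S).
Proof. by move=> gS T'' pi' M HM s; rewrite pull_comp; exact: gS. Qed.

Lemma elt_system_prod T (s : system T) : all_prop (fun q => elt q.2) s ->
  (forall t, elt (system_prod s t)) /\
  exists2 K, 0 <= K & forall t w, `|system_prod s t w| <= K.
Proof.
elim: s => [_|[p f] s IH /= [ef /IH[es [K K0 sK]]]].
  have E t : system_prod (@nil (poly_family T * (Omega T -> R))) t = fun=> 1.
    by apply/funext => w; rewrite /system_prod big_nil.
  split=> [t|]; first by rewrite E; exact: (fa_cst elt_alg).
  by exists 1 => // t w; rewrite E normr1.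
have E t w : system_prod ((p, f) :: s) t w = act (p^~ t) f w * system_prod s t w.
  by rewrite /system_prod big_cons.
split=> [t|].
  rewrite [X in elt X](funext (E t)); apply: (fa_mul elt_alg) => //.
  exact: elt_act.
have [_ [C fC]] := ef; exists (`|C| * K) => [|t w]; first by rewrite mulr_ge0.
rewrite E normrM ler_pM// (le_trans (fC _))//; exact: ler_norm.
Qed.

Definition lift_poly T (p : poly_family T) : poly_family (T * nat) :=
  fun th => p th.1.

Definition lift_fun T (f : Omega T -> R) : Omega (T * nat) -> R :=
  fun w => f (w.1.1, w.1.2.1, w.2).

Lemma elt_lift_fun T (f : Omega T -> R) : elt f -> elt (lift_fun f).
Proof.
by move=> [Lf [C fC]]; split=> [n th|]; [exact: Lf|exists C => w; exact: fC].
Qed.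

(** The component [th.2] is the shift [m]. With [p] zero this is the sequence that moves [b]. *)
Definition shifted T (c p : poly_family T) : poly_family (T * nat) :=
  fun th t => p th.1 (th.2 + t)%N + (c th.1 t - c th.1 (th.2 + t)%N).

Definition reduced_system T (s : system T) (c : poly_family T) b :
    system (T * nat) :=
  [seq (lift_poly q.1, lift_fun q.2) | q <- s] ++
  (shifted c (fun _ _ => 0), lift_fun b) :: [seq (shifted c q.1, lift_fun q.2) | q <- s].

Lemma reduced_system_avg T (s : system T) c b :
  system_avg (reduced_system s c b) = reduced_avg c (system_prod s) b.
Proof.
apply/funext => N; apply/funext => -[[n [th m]] x].
rewrite /system_avg /reduced_avg; congr (cesaro _ _); apply/funext => t /=.
rewrite /system_prod big_cat big_cons !big_map/=; congr (_ * (_ * _)).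
  by rewrite /act /shifted /lift_fun /= add0r.
apply: eq_bigr => q _; rewrite /act /shifted /lift_fun/=.
by rewrite (is_actD LI).
Qed.

Lemma cauchy_reduction T (M : nat -> (T -> R) -> R) (s : system T) c g :
  means M -> all_prop (fun q => elt q.2) s -> elt g ->
  (forall N b, tends_to_oo N -> elt b ->
    cauchy2 (prod_means (M := M) N) (system_avg (reduced_system s c b))) ->
  cauchy2 M (system_avg ((c, g) :: s)).
Proof.
move=> HM es eg H; have [eP [K K0 PK]] := elt_system_prod es.
have -> : system_avg ((c, g) :: s) = wavg c (system_prod s) g.
  apply/funext => N; apply/funext => w; congr (cesaro _ _); apply/funext => t.
  by rewrite /system_prod big_cons.
apply: (cauchy_wavg_reduction HM K0 PK eP) => // N b Noo eb.
by rewrite -reduced_system_avg; exact: H.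
Qed.

(** A sequence in a ball of radius 0 is [c] plus a constant [a]. Replacing [f] by [act a f] merges
    all such factors into one function moved by [c]. *)
Lemma merge_ball0 T (c : poly_family T) S (s : system T) :
  in_cover ((c, 0%N) :: S) s ->
  exists g s', [/\ elt g, in_cover S s' &
    forall N, system_avg s N = system_avg ((c, g) :: s') N].
Proof.
move=> sS; suff [g [s' [eg s'S E]]] : exists g s', [/\ elt g, in_cover S s' &
    forall t w, system_prod s t w = system_prod ((c, g) :: s') t w].
  exists g, s'; split=> // N; apply/funext => w; congr (cesaro _ _).
  by apply/funext => t.
elim: s sS => [_|[p f] s IH /= [[ef pS] /IH[g [s' [eg s'S E]]]]].
  exists (fun=> 1), [::]; split=> // [|t w]; first exact: (fa_cst elt_alg).
  by rewrite /system_prod big_seq1 big_nil.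
case: pS => [pc|pS]; last first.
  exists g, ((p, f) :: s'); split=> // t w.
  rewrite /system_prod in E *; rewrite big_cons E !big_cons /=; ring.
pose a th := p th 0%N - c th 0%N.
exists (fun w => act a f w * g w), s'; split=> //.
  by apply: (fa_mul elt_alg) => //; exact: elt_act.
move=> t w; rewrite /system_prod in E *; rewrite big_cons E !big_cons mulrA.
congr (_ * _ * _); rewrite /act/= -(is_actD LI); congr (f (_, tau _ _)).
by have /= := pc w.1.2 t; rewrite -/(a w.1.2) => <-; rewrite subrK.
Qed.

(** The radius exceeds that of the ball by one because [shifted] differs from [p] by a difference of
    [c - p], which lowers the degree by one. *)
Definition compatible T (c : poly_family T) (S : seq (poly_family T * nat)) :=
  all_prop (fun b => dist_le b.2.+1 c b.1) S.

Lemma compatible_pull T T' (pi : T' -> T) c S :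
  compatible c S -> compatible (fun th => c (pi th)) (pull pi S).
Proof. by apply: all_prop_map => b cb th; exact: cb. Qed.

(** [shifted c p] is [p] minus the difference by [m] of [c - p]. As [c - p] has degree at most
    [r.+1], this correction has degree at most [r]. *)
Lemma covered_shifted T (c p : poly_family T) S :
  compatible c S -> covered S p -> covered (pull fst S) (shifted c p).
Proof.
elim: S => //= -[b r] S IH /= [cb cS] [pb|]; last by right; exact: IH.
left=> -[th m] /=.
have /= cp : dist_le r.+1 c p.
  by apply: dist_le_trans cb _; apply: dist_le_leq (dist_le_sym pb).
have := deg_leB (pb th) (cp th m); congr (deg_le r _); apply/funext => t.
rewrite /shifted/= !opprB.
by rewrite [LHS](AC (2*(2*2)) ((1*4)*((5*(3*6))*2)))/= subrr add0r.
Qed.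


(* The zero family accounts for the factor b created by a reduction, so it has
   to remain covered. *)
Lemma good_cons0 T (c : poly_family T) S :
  compatible c S -> covered S (fun _ _ => 0) -> good S -> good ((c, 0%N) :: S).
Proof.
move=> cS S0 gS T' pi M HM s /merge_ball0 [g [s' [eg s'S E]]].
have -> : system_avg s = system_avg (((fun th => c (pi th)), g) :: s').
  by apply/funext => N; exact: E.
apply: cauchy_reduction => //; first by apply: sub_all_prop s'S => q [].
move=> N b Noo eb; apply: (gS _ (pi \o fst)); first exact: means_prod.
rewrite -pull_comp; apply: all_prop_cat.
  apply: all_prop_map s'S => q [eq qS]; split; first exact: elt_lift_fun.
  exact: (covered_pull fst qS).
have cS' := compatible_pull pi cS.
split; first split; first exact: elt_lift_fun.
  exact: (covered_shifted cS' (covered_pull pi S0)).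
apply: all_prop_map s'S => q [eq qS]; split; first exact: elt_lift_fun.
exact: covered_shifted.
Qed.

(** A system is finite, so its own sequences from the large ball can serve as centers. *)
Lemma split_ball T e (c : poly_family T) S (s : system T) :
  in_cover ((c, e.+1) :: S) s ->
  exists cs : seq (poly_family T), all_prop (fun c' => dist_le e.+1 c' c) cs /\
    in_cover ([seq (c', e) | c' <- cs] ++ S) s.
Proof.
elim: s => [_|[p f] s IH /= [[ef pS] /IH[cs [csc csS]]]]; first by exists [::].
case: pS => [pc|pS]; last first.
  by exists cs; split=> //; split=> //; split=> //; apply: covered_cat; right.
exists (p :: cs); split=> //; split; last first.
  by apply: sub_all_prop csS => q [eq qS]; split=> //=; right.
by split=> //=; left; exact: dist_le_refl.
Qed.

(** Balls are added one at a time. Centers taken from one ball of radius [e.+1] are within [e.+1] of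
    each other, which is compatibility at radius [e]. *)
Lemma good_centers T e (c : poly_family T) cs S :
  (forall (c' : poly_family T) S', all_prop (fun b => (e <= b.2)%N) S' -> compatible c' S' ->
    covered S' (fun _ _ => 0) -> good S' -> good ((c', e) :: S')) ->
  all_prop (fun b => (e <= b.2)%N) S -> covered S (fun _ _ => 0) -> good S ->
  all_prop (fun c' => dist_le e.+1 c' c /\ compatible c' S) cs ->
  good ([seq (c', e) | c' <- cs] ++ S).
Proof.
move=> Hcons eS S0 gS; elim: cs => //= c1 cs IH [[c1c c1S] csc].
apply: Hcons; last exact: IH.
- by apply: all_prop_cat eS; apply: all_prop_map csc.
- apply: all_prop_cat c1S; apply: all_prop_map csc => c' [c'c _] /=.
  exact: dist_le_trans c1c (dist_le_sym c'c).
- by apply: covered_cat; right.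
Qed.

Lemma pull_id T (S : seq (poly_family T * nat)) : pull id S = S.
Proof. by rewrite /pull -[RHS]map_id; apply: eq_map => -[]. Qed.

(** Induction on the radius. The lower bound on the radii in [S] makes the centers produced by
    [split_ball] compatible with [S]. *)
Lemma good_cons e : forall T (c : poly_family T) S,
  all_prop (fun b => (e <= b.2)%N) S -> compatible c S ->
  covered S (fun _ _ => 0) -> good S -> good ((c, e) :: S).
Proof.
elim: e => [|e IH] T c S eS cS S0 gS; first exact: good_cons0.
move=> T' pi M HM s /split_ball[cs [csc sS]].
have eS' : all_prop (fun b => (e < b.2)%N) (pull pi S) by exact: all_prop_map eS.
have : good ([seq (c', e) | c' <- cs] ++ pull pi S).
  apply: (good_centers (c := fun th => c (pi th))) => //.
  - exact: IH.
  - by apply: sub_all_prop eS' => b /ltnW.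
  - exact: (covered_pull pi S0).
  - exact: good_pull.
  - apply: sub_all_prop csc => c' c'c; split=> //.
    apply: all_prop2 eS' (compatible_pull pi cS) => b eb.
    by apply: dist_le_trans; apply: dist_le_leq c'c; rewrite ltnS ltnW.
by move=> /(_ _ id M HM s); rewrite pull_id; apply.
Qed.

(** At radius 0 the sequences are constant and the averages do not depend on [N]. At radius [e.+1]
    the ball is split, and the pieces are added to the ball of radius [e] about zero, which is good
    by induction and covers the zero family. *)
Lemma good_ball0 T e : good [:: ((fun _ _ => 0) : poly_family T, e)].
Proof.
elim: e T => [|e IH] T T' pi M HM s.
  move=> /merge_ball0[g [[|q s'] [eg s'0 E]]]; last by case: s'0 => -[].
  have {}E N w : system_avg s N w = act (fun=> 0) g w.
    rewrite E -[RHS](cesaro_cst N); congr (cesaro _ _); apply/funext => t.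
    by rewrite /system_prod big_seq1.
  move=> r r0; exists 0%N => N N' _ _; rewrite (@eq_mexp _ _ _ (fun=> 0)).
    by rewrite (st_cst elt_alg (state_mexp HM)) ltW.
  by move=> w; rewrite !E subrr expr0n.
move=> /split_ball[cs [csc sS]].
have : good ([seq (c', e) | c' <- cs] ++ [:: ((fun _ _ => 0) : poly_family T', e)]).
  apply: (good_centers (c := fun _ _ => 0)) => //=.
  - exact: good_cons.
  - by left; exact: dist_le_refl.
  - by apply: sub_all_prop csc => c' c'c; split.
move=> /(_ _ id M HM s); rewrite pull_id; apply.
apply: sub_all_prop sS => q [eq qS]; split=> //; apply: covered_cat; left.
by rewrite cats0 in qS.
Qed.

End covers.

Theorem polynomial_cesaro_cauchy r (J : Type) (s : seq J) (p : J -> nat -> V)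
    (f : J -> X -> R) :
  (forall j, deg_le r (p j)) -> (forall j, L (f j)) ->
  forall e : R, 0 < e -> exists N0, forall N N', (N0 <= N)%N -> (N0 <= N')%N ->
    I (fun x =>
      (cesaro N (fun t => \prod_(j <- s) f j (tau (p j t) x)) -
       cesaro N' (fun t => \prod_(j <- s) f j (tau (p j t) x))) ^+ 2) <= e.
Proof.
move=> pr Lf.
(* With a one-point parameter space the expectation is the ultralimit of a constant sequence, which
   is [I] itself. *)
pose M (n : nat) (phi : unit -> R) := phi tt.
have HM : means M by move=> n; split=> // phi _; exact.
pose sys : system unit := [seq ((fun _ => p j), (fun w => f j w.2)) | j <- s].
have sysS : in_cover [:: ((fun _ _ => 0) : poly_family unit, r)] sys.
  rewrite {}/sys; elim: s => //= j s' IH; split=> //; split.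
    split=> [n th|]; first exact: Lf.
    by have [C fC] := is_bounded LI (Lf j); exists C => w; exact: fC.
  left=> th; have := pr j; congr (deg_le r _); apply/funext => t.
  by rewrite subr0.
have := @good_ball0 unit r unit id M HM sys; rewrite pull_id => /(_ sysS) H e e0.
have [N0 HN0] := H e e0; exists N0 => N N' N0N N0N'.
have := HN0 _ _ N0N N0N'; congr (_ <= _).
rewrite -[RHS](@ulim_cst R U UU); congr ulim; apply/funext => n.
rewrite /M; congr I; apply/funext => x; congr ((_ - _) ^+ 2);
  congr (cesaro _ _); apply/funext => t; by rewrite /system_prod big_map.
Qed.
End systems.

(** * Averages in continuous time *)

Definition bounded_measurable (R : realType) d (T : measurableType d)
    (f : T -> R) : Prop :=
  measurable_fun setT f /\ exists C, forall x, `|f x| <= C.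

Section bounded_measurable_theory.
Context {R : realType} {d} {T : measurableType d}.
Local Notation L := (@bounded_measurable R d T).

Lemma function_algebra_bounded_measurable : function_algebra L.
Proof.
split.
- by move=> c; split; [exact: measurable_cst|exists `|c|].
- move=> f g [mf [C fC]] [mg [D gD]]; split; first exact: measurable_funD.
  exists (C + D) => x; rewrite (le_trans (ler_normD _ _))//.
  exact: lerD.
- move=> f g [mf [C fC]] [mg [D gD]]; split; first exact: measurable_funM.
  by exists (C * D) => x; rewrite normrM ler_pM.
Qed.

Lemma bounded_measurable_integrable (m : {measure set T -> \bar R}) D f :
  measurable D -> (m D < +oo)%E -> L f -> m.-integrable D (EFin \o f).
Proof.
move=> mD Dfin [mf [C fC]]; apply: measurable_bounded_integrable => //.
  exact: measurable_funTS.
by exists C; split; [exact: num_real|move=> y Cy x _; exact: le_trans (fC x) (ltW Cy)].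
Qed.

Lemma state_Rintegral (m : {measure set T -> \bar R}) D :
  measurable D -> m D = 1%E -> state L (fun f => \int[m]_(x in D) f x).
Proof.
move=> mD D1; have Dfin : (m D < +oo)%E by rewrite D1 ltry.
have Hi f : L f -> m.-integrable D (EFin \o f).
  exact: bounded_measurable_integrable.
split.
- exact: function_algebra_bounded_measurable.
- by move=> f g Lf Lg; rewrite RintegralD//; exact: Hi.
- by move=> c f Lf; rewrite RintegralZl//; exact: Hi.
- by move=> f Lf f0; apply: Rintegral_ge0.
- by rewrite Rintegral_cst// D1 mulr1.
Qed.

End bounded_measurable_theory.

Section measurable_sections.
Context {R : realType} d1 d2 (T1 : measurableType d1) (T2 : measurableType d2).
Context (m : {sigma_finite_measure set T1 -> \bar R}).

(** The indicator of [D] is absorbed into the integrand and Tonelli is applied to positive and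
    negative parts. Infinite values are sent to 0 by [fine], which is measurable. *)
Lemma measurable_Rintegral (D : set T1) (G : T1 * T2 -> R) :
  measurable D -> measurable_fun setT G ->
  measurable_fun setT (fun y => \int[m]_(x in D) G (x, y)).
Proof.
move=> mD mG; rewrite /Rintegral.
apply: (measurableT_comp (fine_measurable measurableT)) => //=.
pose H := fun z : T1 * T2 => (\1_D z.1 * G z)%:E.
have mH : measurable_fun setT H.
  apply/measurable_EFinP; apply: measurable_funM => //.
  have mI : measurable_fun setT (\1_D : T1 -> R) by exact: measurable_indic.
  exact: (measurableT_comp mI measurable_fst).
rewrite (_ : (fun y => _) = (fun y =>
    (fubini_G m (fun z => (H^\+ z)%E) y - fubini_G m (fun z => (H^\- z)%E) y)%E)).
  apply: emeasurable_funB.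
    by apply: measurable_fun_fubini_tonelli_G => //; exact: measurable_funepos.
  by apply: measurable_fun_fubini_tonelli_G => //; exact: measurable_funeneg.
apply/funext => y; rewrite integral_mkcond integralE /fubini_G.
congr (_ - _)%E; apply: eq_integral => x _.
  rewrite !funeposE patchE /H /= indicE.
  by case: ifP => _; rewrite ?mul1r ?mul0r.
rewrite !funenegE patchE /H /= indicE.
by case: ifP => _; rewrite ?mul1r ?mul0r.
Qed.

End measurable_sections.
Lemma Rintegral_preserved (R : realType) d (T : measurableType d)
    (m : {measure set T -> \bar R}) (phi : T -> T) (D : set T) (f : T -> R) :
  measurable_fun setT phi ->
  (forall A, measurable A -> m (phi @^-1` A) = m A) ->
  measurable D -> (m D < +oo)%E -> bounded_measurable f ->
  \int[m]_(x in phi @^-1` D) f (phi x) = \int[m]_(x in D) f x.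
Proof.
move=> mphi phim mD Dfin [mf [C fC]]; rewrite /Rintegral; congr fine.
have mphiD : measurable (phi @^-1` D) by rewrite -[_ @^-1` _]setTI; exact: mphi.
have -> : (\int[m]_(x in D) (f x)%:E =
    \int[pushforward m phi]_(x in D) (f x)%:E)%E.
  apply: (eq_measure_integral (pushforward m phi)) => A mA _.
  exact/esym/phim.
rewrite integral_pushforward//; first exact/measurable_EFinP.
apply: (bounded_measurable_integrable (f := f \o phi)) => //.
  by rewrite phim.
by split; [exact: measurableT_comp|exists C => x; exact: fC].
Qed.

(** * Translation of Lebesgue measure and unit steps *)

Section translation.
Context {R : realType}.
Local Notation leb := (@lebesgue_measure R).

(** Uniqueness of Lebesgue measure: the pushforward has the right values on half-open intervals. *)
Lemma lebesgue_measureD (a : R) (A : set R) : measurable A ->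
  leb ((fun s => s + a) @^-1` A) = leb A.
Proof.
have ma : measurable_fun setT (fun s : measurableTypeR R => (s + a : measurableTypeR R)).
  exact: measurable_funD.
move=> mA.
have := @lebesgue_measure_unique R (pushforward leb (fun s : measurableTypeR R => (s + a : measurableTypeR R))).
move=> /(_ ma _ A mA) ->// _ [[u v]] _ <-.
transitivity (leb `]u - a, v - a]%classic); last first.
  apply: (congr1 leb); apply/seteqP; split=> x /=;
  by rewrite !in_itv/= ltrBlDr lerBrDr.
rewrite !lebesgue_measure_itv/= !lte_fin ltrD2r; case: ifP => // _.
by rewrite -!EFinB; congr EFin; ring.
Qed.

Lemma Rintegral_translation (G : R -> R) (a : R) : bounded_measurable G ->
  \int[leb]_(s in `[0, 1]) G (s + a) = \int[leb]_(s in `[a, a + 1]) G s.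
Proof.
move=> bG.
have ma : measurable_fun setT (fun s : measurableTypeR R => (s + a : measurableTypeR R)).
  exact: measurable_funD.
rewrite -(Rintegral_preserved ma (m := leb) (D := `[a, a + 1]) (f := G))//.
- congr (Rintegral _ _ _); apply/seteqP; split=> x /=; rewrite !in_itv/=.
    by rewrite lerDr addrC lerD2l.
  by rewrite lerDr addrC lerD2l.
- by move=> A mA; exact: lebesgue_measureD.
- by rewrite /= lebesgue_measure_itv/=; case: ifP => // _; rewrite -EFinB ltry.
Qed.

Lemma Rintegral_unit_steps (G : R -> R) N : bounded_measurable G ->
  \int[leb]_(t in `[0, N%:R]) G t =
  \sum_(i < N) \int[leb]_(s in `[0, 1]) G (s + i%:R).
Proof.
move=> bG; have iG (b : R) : leb.-integrable `[0, b] (EFin \o G).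
  apply: bounded_measurable_integrable => //.
  by rewrite /= lebesgue_measure_itv/=; case: ifP => // _; rewrite -EFinB ltry.
elim: N => [|N IH]; first by rewrite big_ord0 set_itv1 Rintegral_set1.
rewrite big_ord_recr -IH /= Rintegral_translation//.
have := @Rintegral_itvB R G (BLeft 0) (BRight N.+1%:R) N%:R (iG _).
rewrite !bnd_simp ler0n ler_nat => /(_ isT (leqnSn _)).
move=> /eqP; rewrite subr_eq => /eqP ->.
rewrite addrC natr1; congr (_ + _); rewrite Rintegral_itv_obnd_cbnd//.
apply: bounded_measurable_integrable => //.
by rewrite /= lebesgue_measure_itv/=; case: ifP => // _; rewrite -EFinB ltry.
Qed.

End translation.
Lemma bounded_convergence (R : realType) d (T : measurableType d)
    (m : {measure set T -> \bar R}) (D : set T) (f_ : nat -> T -> R)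
    (f : T -> R) (C : R) :
  measurable D -> (m D < +oo)%E ->
  (forall n, measurable_fun setT (f_ n)) -> measurable_fun setT f ->
  (forall n x, `|f_ n x| <= C) ->
  {ae m, forall x, D x -> f_ n x @[n --> \oo] --> f x} ->
  \int[m]_(x in D) f_ n x @[n --> \oo] --> \int[m]_(x in D) f x.
Proof.
move=> mD Dfin mf_ mf fC ff.
have iC : m.-integrable D (EFin \o cst C).
  apply: bounded_measurable_integrable => //.
  by split; [exact: measurable_cst|exists `|C|].
have [|||||fi _ ci] := @dominated_convergence _ _ _ m D mD
  (fun n x => (f_ n x)%:E) (EFin \o f) (EFin \o cst C).
- by move=> n; apply/measurable_EFinP; exact: measurable_funTS.
- by apply/measurable_EFinP; exact: measurable_funTS.
- apply: filterS ff => x ffx Dx /=; apply: cvg_EFin; last exact: ffx.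
  by apply: nearW => n.
- exact: iC.
- by apply: aeW => x n _ /=; rewrite lee_fin.
have fin : (\int[m]_(x in D) (f x)%:E)%E \is a fin_num by exact: integrable_fin_num.
by apply: (fine_cvg (f := fun n => (\int[m]_(x in D) (f_ n x)%:E)%E)); rewrite fineK.
Qed.

(** * Limits in [L^2] of bounded families *)

Section L2_limit.
Context {R : realType} d {X : measurableType d} {mu : probability X R}.

Let SX : state (@bounded_measurable R d X) (fun f => \int[mu]_x f x).
Proof. by apply: state_Rintegral => //; exact: probability_setT. Qed.

Let AX : function_algebra (@bounded_measurable R d X) :=
  function_algebra_bounded_measurable.

(** By Jensen the increments have [L^1] norms at most [1 / 2 ^ k.+1], with sum at most 1. The sum of
    their absolute values is therefore integrable, hence finite almost everywhere, and the
    telescoping series converges absolutely. *)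
Lemma summable_increments_cvg (h : nat -> X -> R) :
  (forall k, bounded_measurable (h k)) ->
  (forall k, \int[mu]_x (h k.+1 x - h k x) ^+ 2 <= (1 / (2 ^ k.+1)%:R) ^+ 2) ->
  {ae mu, forall x, cvgn (h^~ x)}.
Proof.
move=> bh hk.
pose D k x := `|h k.+1 x - h k x|.
have bD k : bounded_measurable (D k).
  have [mf [C fC]] := fa_sub AX (bh k.+1) (bh k).
  split; first exact: measurableT_comp.
  by exists C => x; rewrite /D normr_id.
have iD k : mu.-integrable setT (EFin \o D k).
  apply: bounded_measurable_integrable => //.
  by rewrite -ge0_fin_numE ?fin_num_measure.
have D1 k : (\int[mu]_x (D k x)%:E <= (1 / (2 ^ k.+1)%:R)%:E)%E.
  rewrite -[leLHS]fineK; last exact: integrable_fin_num (iD k).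
  rewrite lee_fin; set y := fine _.
  have y0 : 0 <= y by apply: Rintegral_ge0 => x _; exact: normr_ge0.
  rewrite -(@ler_pXn2r _ 2 isT) ?nnegrE ?divr_ge0//.
  apply: (le_trans _ (hk k)); apply: le_trans (st_sqr AX SX (bD k)) _.
  apply: (st_le AX SX); [exact: (fa_sqr AX)| |] => [|x].
    by apply: (fa_sqr AX); exact: (fa_sub AX).
  by rewrite /D real_normK ?num_real.
have mS : measurable_fun setT (fun x => \sum_(0 <= k <oo) (D k x)%:E)%E.
  apply: ge0_emeasurable_sum => [k x _ _|k _]; first by rewrite lee_fin normr_ge0.
  by apply/measurable_EFinP; have [] := bD k.
have iS : mu.-integrable setT (fun x => \sum_(0 <= k <oo) (D k x)%:E)%E.
  apply/integrableP; split=> //.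
  under eq_integral => x _ do
    (rewrite gee0_abs; last by apply: nneseries_ge0 => k _ _; rewrite lee_fin normr_ge0).
  rewrite (@integral_nneseries _ _ _ mu _ measurableT (fun k x => (D k x)%:E));
    last 2 first.
  - by move=> k; apply/measurable_EFinP; have [] := bD k.
  - by move=> k x _; rewrite lee_fin normr_ge0.
  apply: (@le_lt_trans _ _ 1%E); last exact: ltry.
  apply: le_trans (epsilon_trick0 xpredT ler01).
  apply: lee_nneseries => // k _ _.
  by apply: integral_ge0 => x _; rewrite lee_fin normr_ge0.
apply: filterS (integrable_ae measurableT iS) => x /(_ I) Sx.
have cD : cvgn (series (D^~ x)).
  apply: nnseries_is_cvg => [k|]; first exact: normr_ge0.
  by rewrite -ge0_fin_numE//; apply: nneseries_ge0 => k _ _; rewrite lee_fin normr_ge0.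
have := @normed_cvg R R^o (telescope (h^~ x)) cD.
rewrite telescopeK => /cvg_ex[l hl]; apply/cvg_ex; exists (l + h 0%N x).
rewrite (_ : h^~ x = (fun n => (h n x - h 0%N x) + h 0%N x)); last first.
  by apply/funext => n; rewrite subrK.
by apply: cvgD; [exact: hl|exact: cvg_cst].
Qed.

(** A fast subsequence [h] converges almost everywhere, and bounded convergence carries the Cauchy
    estimates over to its limit. *)
Lemma bounded_cauchy_L2_cvg (a : R -> X -> R) (K : R) :
  (forall T, measurable_fun setT (a T)) -> (forall T x, `|a T x| <= K) ->
  (forall e : R, 0 < e -> exists T0, forall T T', T0 <= T -> T0 <= T' ->
    \int[mu]_x (a T x - a T' x) ^+ 2 <= e) ->
  exists g : X -> R, bounded_measurable g /\
    forall e : R, 0 < e -> exists T0, forall T, T0 <= T ->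
      \int[mu]_x (a T x - g x) ^+ 2 <= e.
Proof.
move=> ma aK ca.
have ba T : bounded_measurable (a T) by split; [|exists K].
pose ek k : R := (1 / (2 ^ k.+1)%:R) ^+ 2.
have ek0 k : 0 < ek k by rewrite exprn_gt0// divr_gt0// ltr0n expn_gt0.
have /choice[t ht] : forall k, exists T0, forall T T', T0 <= T -> T0 <= T' ->
    \int[mu]_x (a T x - a T' x) ^+ 2 <= ek k.
  by move=> k; exact: ca.
(* [r j] is at least every threshold [t k] with [k <= j]. *)
pose r k := \sum_(j < k.+1) `|t j|.
have tr k j : (k <= j)%N -> t k <= r j.
  move=> kj; rewrite (le_trans (ler_norm _))// /r.
  have kj' : (k < j.+1)%N by [].
  by rewrite (bigD1 (Ordinal kj'))//= lerDl sumr_ge0.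
pose h k := a (r k).
have ch : {ae mu, forall x, cvgn (h^~ x)}.
  apply: summable_increments_cvg => [k|k]; first exact: ba.
  by apply: ht; exact: tr.
have bdh x : has_ubound (range (h^~ x)) /\ has_lbound (range (h^~ x)).
  split; [exists K => _ [k _ <-]|exists (- K) => _ [k _ <-]].
    exact: le_trans (ler_norm _) (aK _ _).
  by have := aK (r k) x; rewrite ler_norml => /andP[].
pose g0 x := limn_sup (h^~ x).
have mg0 : measurable_fun setT g0.
  apply: measurable_fun_limn_sup => [x _|x _|k]; last exact: ma.
    by have [] := bdh x.
  by have [] := bdh x.
(* The clamp gives a bound at every point and leaves the limits of [h] unchanged. *)
pose g x := Num.min K (Num.max (- K) (g0 x)).
have mg : measurable_fun setT g.
  by apply: measurable_minr => //; exact: measurable_maxr.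
have bg : bounded_measurable g.
  split=> //; exists `|K| => x; rewrite /g ler_norml; apply/andP; split.
    rewrite le_min; apply/andP; split; first by rewrite lerNl ler_normr lexx orbT.
    by rewrite le_max lerN2 ler_norm.
  by rewrite (le_trans _ (ler_norm _))// ge_min lexx.
have hg : {ae mu, forall x, h k x @[k --> \oo] --> g x}.
  apply: filterS ch => x cx.
  suff -> : g x = limn (h^~ x) by [].
  have g0E : g0 x = limn (h^~ x) by apply: cvg_limn_supE => //; have [] := bdh x.
  have l1 : - K <= limn (h^~ x).
    apply: limr_ge => //; apply: nearW => k.
    by have := aK (r k) x; rewrite ler_norml => /andP[].
  have l2 : limn (h^~ x) <= K.
    by apply: limr_le => //; apply: nearW => k; exact: le_trans (ler_norm _) (aK _ _).
  by rewrite /g g0E max_r// min_r.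
exists g; split=> // e e0.
have [k0 k0e] : exists k, ek k <= e.
  exists (Num.bound e^-1); set k := Num.bound _.
  have ke : e^-1 < k%:R by rewrite archi_boundP// invr_ge0 ltW.
  have k1 : k%:R < (2 ^ k.+1)%:R :> R.
    by rewrite ltr_nat (ltn_trans (ltnSn _))// ltn_expl.
  have k2 : (2 ^ k.+1)%:R^-1 <= e.
    by rewrite -[leRHS]invrK lef_pV2 ?posrE ?invr_gt0 ?ltr0n ?expn_gt0// ltW// (lt_trans ke).
  rewrite /ek div1r expr2 (le_trans _ k2)// ler_piMl ?invr_ge0//.
  by rewrite invf_le1 ?ltr0n ?expn_gt0// ler1n expn_gt0.
exists (t k0) => T TT0.
have ba2 k : bounded_measurable (fun x => (a T x - h k x) ^+ 2).
  by apply: (fa_sqr AX); exact: (fa_sub AX (ba _) (ba _)).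
have bag : bounded_measurable (fun x => (a T x - g x) ^+ 2).
  by apply: (fa_sqr AX); exact: (fa_sub AX).
have : \int[mu]_x (a T x - h k x) ^+ 2 @[k --> \oo] -->
       \int[mu]_x (a T x - g x) ^+ 2.
  apply: (bounded_convergence (C := (K + K) ^+ 2)) => //.
  - by rewrite -ge0_fin_numE ?fin_num_measure.
  - by move=> k; have [] := ba2 k.
  - by have [] := bag.
  - move=> k x; rewrite normrX lerXn2r ?nnegrE//.
      by rewrite addr_ge0// (le_trans (normr_ge0 _) (aK 0 x)).
    exact: le_trans (ler_normB _ _) (lerD (aK _ _) (aK _ _)).
  - apply: filterS hg => x hgx _.
    by apply: cvgM; apply: cvgB => //; exact: cvg_cst.
move=> cT; rewrite -(cvg_lim _ cT)//; apply: limr_le.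
  by apply/cvg_ex; exists (\int[mu]_x (a T x - g x) ^+ 2).
exists k0 => // k /= k0k; rewrite (le_trans _ k0e)//.
by apply: ht => //; exact: tr.
Qed.
End L2_limit.

(** * From sampled averages to continuous time *)

Section continuous_average.
Context {R : realType} d {X : measurableType d} {mu : probability X R}.
Local Notation leb := (@lebesgue_measure R).
Variables (F : R -> X -> R) (K : R).
Hypothesis mF : measurable_fun setT (fun z : R * X => F z.1 z.2).
Hypothesis FK : forall t x, `|F t x| <= K.

Let SX : state (@bounded_measurable R d X) (fun f => \int[mu]_x f x).
Proof. by apply: state_Rintegral => //; exact: probability_setT. Qed.

Let leb01 : leb `[0, 1] = 1%E.
Proof. by rewrite lebesgue_measure_itv/= lte_fin ltr01 oppr0 adde0. Qed.

Let SI : state (@bounded_measurable R _ (measurableTypeR R))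
  (fun f => \int[leb]_(s in `[0, 1]) f s).
Proof. by apply: state_Rintegral => //; exact: leb01. Qed.

Let AX : function_algebra (@bounded_measurable R d X) :=
  function_algebra_bounded_measurable.

Lemma Rintegral_fubini01 (G : R * X -> R) (C : R) : measurable_fun setT G ->
  (forall z, 0 <= G z) -> (forall z, G z <= C) ->
  \int[mu]_x \int[leb]_(s in `[0, 1]) G (s, x) =
  \int[leb]_(s in `[0, 1]) \int[mu]_x G (s, x).
Proof.
move=> mG G0 GC.
have GC' z : `|G z| <= C by rewrite ger0_norm.
have bG1 x : bounded_measurable (fun s : measurableTypeR R => G (s, x)).
  by split; [exact: measurable_fun_pair1|exists C => s].
have bG2 s : bounded_measurable (fun x => G (s, x)).
  by split; [exact: measurable_fun_pair2|exists C => x].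
have m01 : measurable (`[0, 1] : set (measurableTypeR R)) by exact: measurable_itv.
have l01 : (leb `[0%R, 1%R] < +oo)%E by rewrite leb01 ltry.
pose H z : \bar R := (\1_(`[0, 1] : set R) z.1 * G z)%:E.
have mH : measurable_fun setT H.
  apply/measurable_EFinP; apply: measurable_funM => //.
  have mI : measurable_fun setT (\1_(`[0, 1]) : measurableTypeR R -> R).
    exact: measurable_indic.
  exact: (measurableT_comp mI measurable_fst).
have H0 z : (0 <= H z)%E by rewrite lee_fin mulr_ge0// indicE.
have := @fubini_tonelli _ _ _ _ _ leb mu H mH H0.
have -> : (\int[leb]_s \int[mu]_x H (s, x) =
    \int[leb]_(s in `[0%R, 1%R]) (\int[mu]_x G (s, x))%:E)%E.
  rewrite [RHS]integral_mkcond; apply: eq_integral => s _.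
  rewrite patchE /H /= indicE; case: ifPn => _.
    under eq_integral do rewrite mul1r.
    rewrite /Rintegral fineK// integrable_fin_num//.
    apply: bounded_measurable_integrable => //.
    by rewrite -ge0_fin_numE ?fin_num_measure.
  by under eq_integral do rewrite mul0r; rewrite integral0.
have -> : (\int[mu]_x \int[leb]_s H (s, x) =
    \int[mu]_x (\int[leb]_(s in `[0%R, 1%R]) G (s, x))%:E)%E.
  apply: eq_integral => x _.
  rewrite /Rintegral fineK ?integrable_fin_num//.
    rewrite [RHS]integral_mkcond; apply: eq_integral => s _.
    by rewrite patchE /H /= indicE; case: ifPn => _; rewrite ?mul1r ?mul0r.
  exact: (bounded_measurable_integrable (T := measurableTypeR R)).
by move=> E; rewrite /Rintegral E.
Qed.

Definition time_avg (T : R) x := T^-1 * \int[leb]_(t in `[0, T]) F t x.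

Definition sampled_avg N s x := cesaro N (fun t => F (s + t%:R) x).

Let bF1 x : bounded_measurable (F^~ x : measurableTypeR R -> R).
Proof.
by split; [exact: (measurable_fun_pair1 x mF)|exists K => t; exact: FK].
Qed.

Lemma measurable_shiftF a : measurable_fun setT (fun z : R * X => F (z.1 + a) z.2).
Proof.
have mz : measurable_fun setT (fun z : R * X => (z.1 + a, z.2)).
  apply: measurable_fun_pair; last exact: measurable_snd.
  by apply: measurable_funD => //; exact: measurable_fst.
exact: (measurableT_comp mF mz).
Qed.

Lemma measurable_sampled_avg N :
  measurable_fun setT (fun z : R * X => sampled_avg N z.1 z.2).
Proof.
apply: measurable_funM => //; apply: measurable_sum => i.
exact: measurable_shiftF.
Qed.

Lemma sampled_avg_norm N s x : `|sampled_avg N s x| <= K.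
Proof. by apply: cesaro_norm => t _; exact: FK. Qed.

(** The mean of index [N] has [N.+1] terms, hence the length [N.+1%:R]. *)
Lemma time_avg_nat N x :
  time_avg N.+1%:R x = \int[leb]_(s in `[0, 1]) sampled_avg N s x.
Proof.
rewrite /time_avg Rintegral_unit_steps; last exact: bF1.
apply/esym/(st_cesaro function_algebra_bounded_measurable N SI
  (T := measurableTypeR R) (f := fun t (s : R) => F (s + t%:R) x)) => t.
split; first exact: (measurable_fun_pair1 x (measurable_shiftF _)).
by exists K => s; exact: FK.
Qed.

Let sampled_diff N N' (z : R * X) : R :=
  (sampled_avg N z.1 z.2 - sampled_avg N' z.1 z.2) ^+ 2.

Let measurable_sampled_diff N N' : measurable_fun setT (sampled_diff N N').
Proof.
by apply: measurable_funX; apply: measurable_funB; exact: measurable_sampled_avg.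
Qed.

Let K0 : R * X -> 0 <= K.
Proof. by move=> z; exact: le_trans (normr_ge0 _) (FK z.1 z.2). Qed.

Let sampled_diff_le N N' z : sampled_diff N N' z <= (K + K) ^+ 2.
Proof.
rewrite /sampled_diff -[leLHS]real_normK ?num_real// lerXn2r ?nnegrE//.
  by rewrite addr_ge0// (K0 z).
by rewrite (le_trans (ler_normB _ _))// lerD// sampled_avg_norm.
Qed.

Let sampled_diff_bounded N N' s : bounded_measurable (fun x => sampled_diff N N' (s, x)).
Proof.
split; first exact: measurable_fun_pair2.
exists ((K + K) ^+ 2) => x; rewrite ger0_norm ?sqr_ge0//; exact: sampled_diff_le.
Qed.

(** Jensen over [s] in [[0, 1]], then Tonelli. *)
Lemma time_avg_sqr_le N N' :
  \int[mu]_x (time_avg N.+1%:R x - time_avg N'.+1%:R x) ^+ 2 <=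
  \int[leb]_(s in `[0, 1])
    \int[mu]_x (sampled_avg N s x - sampled_avg N' s x) ^+ 2.
Proof.
have := Rintegral_fubini01 (measurable_sampled_diff N N')
  (fun z => sqr_ge0 _) (sampled_diff_le N N').
rewrite /sampled_diff/= => <-.
have bs n x : bounded_measurable (fun s : measurableTypeR R => sampled_avg n s x).
  split; first exact: (measurable_fun_pair1 x (measurable_sampled_avg n)).
  by exists K => s; exact: sampled_avg_norm.
have bd x := fa_sqr function_algebra_bounded_measurable
  (fa_sub function_algebra_bounded_measurable (bs N x) (bs N' x)).
have mt n : bounded_measurable (time_avg n.+1%:R).
  rewrite (_ : time_avg n.+1%:R =
    fun x => \int[leb]_(s in `[0, 1]) sampled_avg n s x); last first.
    by apply/funext => x; rewrite time_avg_nat.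
  split; last first.
    exists K => x; apply: (st_norm function_algebra_bounded_measurable SI) => //.
    by move=> s; exact: sampled_avg_norm.
  exact: (measurable_Rintegral leb (measurable_itv _) (measurable_sampled_avg n)).
apply: (st_le AX SX).
- by apply: (fa_sqr AX); exact: (fa_sub AX).
- split.
    exact: (measurable_Rintegral leb (measurable_itv _) (measurable_sampled_diff N N')).
  exists ((K + K) ^+ 2) => x.
  apply: (st_norm function_algebra_bounded_measurable SI) => // s.
  by rewrite ger0_norm ?sqr_ge0//; exact: (sampled_diff_le N N' (s, x)).
- move=> x; rewrite !time_avg_nat.
  rewrite -(st_sub function_algebra_bounded_measurable SI)//.
  apply: (st_sqr function_algebra_bounded_measurable SI).
  exact: (fa_sub function_algebra_bounded_measurable).
Qed.

Hypothesis sampled_cauchy : forall (s e : R), 0 < e ->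
  exists N0, forall N N', (N0 <= N)%N -> (N0 <= N')%N ->
    \int[mu]_x (sampled_avg N s x - sampled_avg N' s x) ^+ 2 <= e.

(** The Cauchy property is given only pointwise in [s]. Pairs [q k] violating the conclusion would
    yield bounded functions [phi k] tending to 0 at every [s], and bounded convergence contradicts
    [time_avg_sqr_le]. *)
Lemma time_avg_cauchy_nat (e : R) : 0 < e ->
  exists N0, forall N N', (N0 <= N)%N -> (N0 <= N')%N ->
    \int[mu]_x (time_avg N.+1%:R x - time_avg N'.+1%:R x) ^+ 2 <= e.
Proof.
move=> e0; apply: contrapT => notC.
have /choice[q Hq] : forall k : nat, exists q : nat * nat,
    [/\ (k <= q.1)%N, (k <= q.2)%N &
      e < \int[mu]_x (time_avg q.1.+1%:R x - time_avg q.2.+1%:R x) ^+ 2].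
  move=> k; apply: contrapT => noq; apply: notC; exists k => N N' kN kN'.
  by rewrite leNgt; apply/negP => h; apply: noq; exists (N, N').
pose phi k s := \int[mu]_x (sampled_avg (q k).1 s x - sampled_avg (q k).2 s x) ^+ 2.
have mphi k : measurable_fun setT (phi k).
  apply: (measurable_Rintegral mu (D := setT)
    (G := fun z : X * R => sampled_diff (q k).1 (q k).2 (z.2, z.1))) => //.
  have mswap : measurable_fun setT (fun z : X * R => (z.2, z.1)).
    by apply: measurable_fun_pair; [exact: measurable_snd|exact: measurable_fst].
  exact: (measurableT_comp (measurable_sampled_diff (q k).1 (q k).2) mswap).
have phi0 s : phi k s @[k --> \oo] --> 0.
  apply/cvgrPdist_le => r r0; have [N0 HN0] := sampled_cauchy s r0.
  exists N0 => // k /= N0k; rewrite sub0r normrN ger0_norm; last first.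
    by apply: Rintegral_ge0 => x _; exact: sqr_ge0.
  by have [q1 q2 _] := Hq k; apply: HN0; exact: leq_trans N0k _.
have : \int[leb]_(s in `[0, 1]) phi k s @[k --> \oo] --> \int[leb]_(s in `[0, 1]) (0 : R).
  apply: (bounded_convergence (T := measurableTypeR R) (C := (K + K) ^+ 2)) => //.
  - by have := leb01 => /= ->; rewrite ltry.
  - move=> k s; apply: (st_norm AX SX) => [|x]; first exact: sampled_diff_bounded.
    rewrite ger0_norm ?sqr_ge0//; exact: (sampled_diff_le _ _ (s, x)).
  - by apply: aeW => s _; exact: phi0.
rewrite (st_cst function_algebra_bounded_measurable SI 0).
move=> /cvgrPdist_le/(_ _ e0)[k _ /(_ k (leqnn k))].
rewrite sub0r normrN leNgt => /negP; apply.
have [_ _ /lt_le_trans] := Hq k; apply.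
exact: le_trans (time_avg_sqr_le _ _) (ler_norm _).
Qed.


Let leb_itv_fin (b c : bool) (u v : R) :
  (leb [set` Interval (BSide b u) (BSide c v)] < +oo)%E.
Proof. by rewrite lebesgue_measure_itv/=; case: ifP => // _; rewrite -EFinB ltry. Qed.

Let bF_integrable (b c : bool) (u v : R) x :
  leb.-integrable [set` Interval (BSide b u) (BSide c v)] (EFin \o F^~ x).
Proof.
apply: (bounded_measurable_integrable (T := measurableTypeR R) (f := F^~ x)).
- exact: measurable_itv.
- exact: leb_itv_fin.
- exact: bF1.
Qed.

Lemma Rintegral_itv_norm (b c : bool) (u v : R) x : u <= v ->
  `|\int[leb]_(t in [set` Interval (BSide b u) (BSide c v)]) F t x| <= K * (v - u).
Proof.
move=> uv; have iF := bF_integrable b c u v x.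
apply: le_trans (le_normr_Rintegral _ iF) _ => //.
have -> : K * (v - u) =
    \int[leb]_(t in [set` Interval (BSide b u) (BSide c v)]) (cst K t).
  rewrite Rintegral_cst//; congr (_ * _).
  have /= := lebesgue_measure_itv (Interval (BSide b u) (BSide c v)).
  move=> /(congr1 fine) => E; apply/esym; apply: etrans E _.
  by rewrite lte_fin; case: ltgtP uv => // -> _; rewrite subrr.
apply: le_Rintegral => //.
- apply: (bounded_measurable_integrable (T := measurableTypeR R)
    (f := fun t : R => `|F t x|)); [exact: measurable_itv|exact: leb_itv_fin|].
  have [mFx [C FC]] := bF1 x; split; first exact: measurableT_comp.
  by exists C => t; rewrite normr_id.
- apply: (bounded_measurable_integrable (T := measurableTypeR R)
    (f := cst K)); [exact: measurable_itv|exact: leb_itv_fin|].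
  by split; [exact: measurable_cst|exists `|K|].
Qed.

Lemma time_avg_norm T x : `|time_avg T x| <= K.
Proof.
have K0x := K0 (0, x).
have [T0|T0] := ltP 0 T; last first.
  (* For negative [T] the interval is empty; at [T = 0] the inverse is 0. *)
  rewrite /time_avg; have [Tn|Tp] := ltP T 0.
    rewrite set_itv_ge ?bnd_simp -?ltNge//.
    by rewrite Rintegral_set0 mulr0 normr0.
  have -> : T = 0 by apply/eqP; rewrite eq_le T0.
  by rewrite invr0 mul0r normr0.
rewrite /time_avg normrM gtr0_norm ?invr_gt0// ler_pdivrMl// mulrC.
by rewrite (le_trans (Rintegral_itv_norm _ _ _ (ltW T0)))// subr0.
Qed.

(** With [A], [B], [C] the integrals over [[0, T]], []T, S]] and [[0, S]], the difference is
    [(S - T) / (T * S) * A - S^-1 * B], and each term is at most [K / T] in absolute value. *)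
Lemma time_avg_near T S x : 0 < T -> T <= S -> S <= T + 1 ->
  `|time_avg T x - time_avg S x| <= 2 * K / T.
Proof.
move=> T0 TS ST; have K0x := K0 (0, x).
have S0 : 0 < S by exact: lt_le_trans TS.
have := @Rintegral_itvB R (F^~ x) (BLeft 0) (BRight S) T (bF_integrable _ _ _ _ _).
rewrite !bnd_simp => /(_ (ltW T0) TS).
have := @Rintegral_itv_norm false false T S x TS.
have := @Rintegral_itv_norm true false 0 T x (ltW T0); rewrite subr0.
rewrite /time_avg.
set A := \int[leb]_(t in _) F t x; set B := \int[leb]_(t in _) F t x.
set C := \int[leb]_(t in _) F t x => AK BK CAB.
have -> : T^-1 * A - S^-1 * C = (S - T) / (T * S) * A - S^-1 * B.
  by rewrite -CAB; field; rewrite !gt_eqF.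
rewrite (le_trans (ler_normB _ _))// !normrM.
have TS0 : 0 <= S - T by rewrite subr_ge0.
have TSi : 0 < (T * S)^-1 by rewrite invr_gt0 mulr_gt0.
have Si : 0 < S^-1 by rewrite invr_gt0.
rewrite (ger0_norm TS0) (gtr0_norm TSi) (gtr0_norm Si).
have ST1 : S - T <= 1 by rewrite lerBlDl.
have h1 : (S - T) / (T * S) * `|A| <= K / T.
  apply: (@le_trans _ _ ((S - T) / (T * S) * (K * T))).
    by rewrite ler_wpM2l// divr_ge0 ?subr_ge0// mulr_ge0// ltW.
  have -> : (S - T) / (T * S) * (K * T) = (K / T) * ((S - T) * T / S).
    by field; rewrite !gt_eqF.
  rewrite ler_piMr ?divr_ge0 ?(ltW T0)//.
  by rewrite ler_pdivrMr// mul1r (le_trans _ TS)// ler_piMl// ltW.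
have h2 : S^-1 * `|B| <= K / T.
  rewrite mulrC ler_pM ?invr_ge0 ?(ltW S0)//.
    by rewrite (le_trans BK)// ler_piMr.
  by rewrite lef_pV2.
by rewrite (le_trans (lerD h1 h2))// -mulrDl -mulr2n mulr_natl.
Qed.

Lemma time_avg_cvg : exists g : X -> R, bounded_measurable g /\
  forall e : R, 0 < e -> exists T0, forall T, T0 <= T ->
    \int[mu]_x (time_avg T x - g x) ^+ 2 <= e.
Proof.
have mt T : measurable_fun setT (time_avg T).
  apply: measurable_funM => //.
  exact: (measurable_Rintegral leb (measurable_itv _) mF).
have bt T : bounded_measurable (time_avg T).
  by split=> //; exists K; exact: time_avg_norm.
apply: (bounded_cauchy_L2_cvg mt time_avg_norm) => e e0.
have e40 : 0 < e / 4 by rewrite divr_gt0.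
have [N0 HN0] := time_avg_cauchy_nat e40.
pose k : R := Num.min 1 (e / 4).
have k0 : 0 < k by rewrite lt_min ltr01.
have k1 : k <= 1 by rewrite ge_min lexx.
have ke : k <= e / 4 by rewrite ge_min lexx orbT.
(* Beyond [4 * |K| / k], moving the time [S] up to [truncn S + 1] changes the average by at most
   [2 * |K| / S <= k / 2]. *)
exists (Num.max N0.+1%:R (4 * `|K| / k)) => T T'.
rewrite !ge_max => /andP[NT KT] /andP[NT' KT'].
have near S : N0.+1%:R <= S -> 4 * `|K| / k <= S -> exists2 N, (N0 <= N)%N &
    forall x, `|time_avg S x - time_avg N.+1%:R x| <= k / 2.
  move=> NS KS; exists (Num.truncn S).
    rewrite truncn_ge_nat; last exact: le_trans (ler0n _ _) NS.
    by apply: le_trans NS; rewrite ler_nat.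
  have S0 : 0 < S by apply: lt_le_trans NS; rewrite ltr0n.
  move=> x; have /andP[S1 S2] := truncn_itv (ltW S0).
  apply: le_trans (time_avg_near x S0 (ltW S2) _) _.
    by rewrite -natr1 lerD2r.
  rewrite ler_pdivrMr//; move: KS; rewrite ler_pdivrMr//.
  by have := ler_norm K; lra.
have [N N0N HN] := near T NT KT; have [N' N0N' HN'] := near T' NT' KT'.
pose u x := time_avg N.+1%:R x - time_avg N'.+1%:R x.
pose v x := (time_avg T x - time_avg N.+1%:R x) -
  (time_avg T' x - time_avg N'.+1%:R x).
have bu : bounded_measurable u by exact: (fa_sub AX).
have bv : bounded_measurable v.
  by apply: (fa_sub AX); exact: (fa_sub AX (bt _) (bt _)).
have vk : \int[mu]_x v x ^+ 2 <= e / 4.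
  apply: (st_le_cst AX SX); first exact: (fa_sqr AX).
  move=> x; rewrite -[leLHS]real_normK ?num_real// (le_trans _ ke)//.
  have vx : `|v x| <= k.
    by rewrite (le_trans (ler_normB _ _))// (le_trans (lerD (HN x) (HN' x)))// -splitr.
  by rewrite expr2 -[leRHS]mulr1 ler_pM// (le_trans vx).
have uk : \int[mu]_x u x ^+ 2 <= e / 4 by exact: HN0.
apply: (@le_trans _ _ (\int[mu]_x (2 * u x ^+ 2 + 2 * v x ^+ 2))).
  apply: (st_le AX SX).
  - by apply: (fa_sqr AX); exact: (fa_sub AX).
  - by apply: (fa_add AX); apply: (fa_scale AX); exact: (fa_sqr AX).
  - move=> x; rewrite (_ : time_avg T x - time_avg T' x = u x + v x); last first.
      by rewrite /u /v; ring.
    by move: (u x) (v x) => y z; have := sqr_ge0 (y - z); nra.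
have bu2 := fa_sqr AX bu; have bv2 := fa_sqr AX bv.
rewrite (st_add SX (fa_scale AX 2 bu2) (fa_scale AX 2 bv2)).
rewrite (st_scale SX _ bu2) (st_scale SX _ bv2); lra.
Qed.

End continuous_average.

(** * Application to the flow *)

Section polynomial_degree.
Context {R : realType}.

Lemma deg_le_shift (V : zmodType) r (h : nat -> V) m :
  deg_le r h -> deg_le r (fun t => h (m + t)%N).
Proof.
elim: r h => [|r IH] h /= hr; first by move=> t; rewrite hr [RHS]hr.
move=> n; have := IH _ (hr n); congr (deg_le r _); apply/funext => t.
by rewrite addnCA.
Qed.

Lemma deg_leZ r (h : nat -> R) (c : R) :
  deg_le r h -> deg_le r (fun t => c * h t).
Proof.
elim: r h => [|r IH] h /= hr; first by move=> t; rewrite hr.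
move=> m; have := IH _ (hr m); congr (deg_le r _); apply/funext => t.
by rewrite mulrBr.
Qed.

(** Discrete Leibniz rule: the difference by [m] of [h t * (s + t)] is that of [h] times [s + t],
    plus [m * h (m + t)]. *)
Lemma deg_le_mulX r (h : nat -> R) (s : R) :
  deg_le r h -> deg_le r.+1 (fun t => h t * (s + t%:R)).
Proof.
elim: r h => [|r IH] h hr.
  by move=> m t /=; rewrite (hr (m + t)%N) (hr t) (hr (m + 0)%N) !natrD; ring.
move=> m; have hm := IH _ (hr m).
have hs := deg_leZ m%:R (deg_le_shift m hr).
have := deg_leD hm hs; congr (deg_le r.+1 _); apply/funext => t.
by rewrite natrD; ring.
Qed.

(** Horner's scheme: each step multiplies by [s + t] and adds a constant. *)
Lemma deg_le_poly (q : {poly R}) :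
  exists r, forall s : R, deg_le r (fun t => q.[s + t%:R]).
Proof.
elim/poly_ind: q => [|q c [r IH]].
  by exists 0%N => s t; rewrite !horner0.
exists r.+1 => s; have h1 := deg_le_mulX s (IH s).
have h2 : deg_le r.+1 (fun=> c) by apply: (@deg_le_leq _ 0).
have := deg_leD h1 h2; congr (deg_le r.+1 _); apply/funext => t.
by rewrite !hornerE.
Qed.

Lemma deg_le_rV r D (h : nat -> 'rV[R]_D) :
  (forall j, deg_le r (fun t => h t ord0 j)) -> deg_le r h.
Proof.
elim: r h => [|r IH] h /= hr.
  by move=> t; apply/rowP => j; exact: hr.
move=> m; apply: IH => j; have := hr j m; congr (deg_le r _).
by apply/funext => t; rewrite !mxE.
Qed.

Lemma deg_le_polynomial_map D k (p : 'I_k -> R -> 'rV[R]_D) :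
  (forall i, polynomial_map (p i)) ->
  exists r, forall i (s : R), deg_le r (fun t => p i (s + t%:R)).
Proof.
move=> pp.
have /choice[r Hr] : forall ij : 'I_k * 'I_D, exists r, forall s : R,
    deg_le r (fun t => p ij.1 (s + t%:R) ord0 ij.2).
  move=> [i j] /=; have [q qE] := pp i j; have [r Hr] := deg_le_poly q.
  exists r => s; have := Hr s; congr (deg_le r _).
  by apply/funext => t; rewrite qE.
exists (\max_ij r ij)%N => i s; apply: deg_le_rV => j.
by apply: deg_le_leq (Hr (i, j) s); exact: leq_bigmax.
Qed.

Lemma polynomial_map_continuous D (p : R -> 'rV[R]_D) :
  polynomial_map p -> continuous p.
Proof.
move=> pp x; apply/cvg_ballP => e e0.
have pj (j : 'I_D) : \forall y \near x, ball (p x ord0 j) e (p y ord0 j).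
  have [q qE] := pp j.
  have qc : (fun y => p y ord0 j) = horner q by apply/funext => y; rewrite qE.
  have := @continuous_horner R q x; rewrite -qc => /cvg_ballP.
  exact.
have : \forall y \near x, forall j : 'I_D, ball (p x ord0 j) e (p y ord0 j).
  exact: (@filter_forall R 'I_D (fun j y => ball (p x ord0 j) e (p y ord0 j)) (nbhs x)).
apply: filterS => y py; split=> // i j; rewrite (ord1 i); exact: py.
Qed.

End polynomial_degree.

(** * Orbit sums of the action *)

Section flow.
Context {R : realType} {D k : nat} {d : measure_display} {X : measurableType d}.
Context {mu : probability X R} {tau : 'rV[R]_D -> X -> X}.
Context {p : 'I_k -> R -> 'rV[R]_D}.
Hypothesis tau_action : rV_action tau.
Hypothesis tau_measurable : jointly_measurable tau.
Hypothesis tau_preserving : preserves_measure tau mu.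
Hypothesis p_poly : forall i, polynomial_map (p i).
Local Notation leb := (@lebesgue_measure R).

Let mu_fin : (mu setT < +oo)%E.
Proof. by rewrite -ge0_fin_numE ?fin_num_measure. Qed.

Let AX : function_algebra (@bounded_measurable R d X) :=
  function_algebra_bounded_measurable.

Let SX : state (@bounded_measurable R d X) (fun f => \int[mu]_x f x).
Proof. by apply: state_Rintegral => //; exact: probability_setT. Qed.

Lemma measurable_tau v : measurable_fun setT (tau v).
Proof. exact: (measurable_fun_pair2 (v : borel_rV R D) tau_measurable). Qed.

Lemma invariant_state_tau :
  invariant_state tau (@bounded_measurable R d X) (fun f => \int[mu]_x f x).
Proof.
have [tau0 tauD] := tau_action; split=> //.
- by move=> f [].
- move=> v f [mf [C fC]]; split; last by exists C => x; exact: fC.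
  by apply: measurableT_comp => //; exact: measurable_tau.
- move=> v f bf; rewrite -[RHS](Rintegral_preserved (measurable_tau v))//.
  by move=> A mA; exact: tau_preserving.
Qed.

Lemma measurable_path i : measurable_fun setT (p i : R -> borel_rV R D).
Proof.
apply: (@measurability _ _ R (borel_rV R D) setT (p i) (@open 'rV[R]_D)) => //.
move=> _ [B oB <-].
rewrite setTI; apply: open_measurable; apply: open_comp => // x _.
exact: polynomial_map_continuous.
Qed.

Lemma measurable_orbit i :
  measurable_fun setT (fun z : R * X => tau (p i z.1) z.2).
Proof.
have mz : measurable_fun setT (fun z : R * X => ((p i z.1 : borel_rV R D), z.2)).
  apply: measurable_fun_pair; last exact: measurable_snd.
  exact: (measurableT_comp (measurable_path i) measurable_fst).
exact: (measurableT_comp tau_measurable mz).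
Qed.

(** The shape of the real or imaginary part of a product of complex factors: [w] picks the real part
    ([false]) or the imaginary part ([true]) of each factor, and [c w] comes from the product of the
    imaginary units. *)
Definition orbit_sum (h : 'I_k -> bool -> X -> R)
    (c : {ffun 'I_k -> bool} -> R) (t : R) x : R :=
  \sum_(w : {ffun 'I_k -> bool}) c w * \prod_i h i (w i) (tau (p i t) x).

Section real_averages.
Variables (h : 'I_k -> bool -> X -> R) (c : {ffun 'I_k -> bool} -> R).
Local Notation orbit_sum := (orbit_sum h c).

Lemma measurable_orbit_sum : (forall i b, measurable_fun setT (h i b)) ->
  measurable_fun setT (fun z : R * X => orbit_sum z.1 z.2).
Proof.
move=> mh.
apply: measurable_sum => w; apply: measurable_funM => //.
apply: measurable_prod => i _.
exact: (measurableT_comp (mh i (w i)) (measurable_orbit i)).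
Qed.

Hypothesis bh : forall i b, bounded_measurable (h i b).

Lemma orbit_sum_bounded : exists K, forall t x, `|orbit_sum t x| <= K.
Proof.
have /choice[C hC] : forall ib : 'I_k * bool, exists C, forall x, `|h ib.1 ib.2 x| <= C.
  by move=> [i b]; have [_] := bh i b.
exists (\sum_(w : {ffun 'I_k -> bool}) `|c w| * \prod_i C (i, w i)) => t x.
apply: (le_trans (ler_norm_sum _ _ _)); apply: ler_sum => w _.
rewrite normrM ler_wpM2l// normr_prod; apply: ler_prod => i _.
by rewrite normr_ge0 (hC (i, w i)).
Qed.

Let cauchy_seq (u : nat -> X -> R) := (forall N, bounded_measurable (u N)) /\
  forall e : R, 0 < e -> exists N0, forall N N', (N0 <= N)%N -> (N0 <= N')%N ->
    \int[mu]_x (u N x - u N' x) ^+ 2 <= e.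

Let cauchy_seqD u v : cauchy_seq u -> cauchy_seq v ->
  cauchy_seq (fun N x => u N x + v N x).
Proof.
move=> [bu cu] [bv cv]; split=> [N|e e0]; first exact: (fa_add AX).
have e40 : 0 < e / 4 by rewrite divr_gt0.
have [N1 H1] := cu _ e40; have [N2 H2] := cv _ e40.
exists (maxn N1 N2) => N N'; rewrite !geq_max => /andP[a1 a2] /andP[b1 b2].
have bdu := fa_sub AX (bu N) (bu N'); have bdv := fa_sub AX (bv N) (bv N').
have bu2 := fa_sqr AX bdu; have bv2 := fa_sqr AX bdv.
apply: (@le_trans _ _ (\int[mu]_x
    (2 * (u N x - u N' x) ^+ 2 + 2 * (v N x - v N' x) ^+ 2))).
  apply: (st_le AX SX).
  - by apply: (fa_sqr AX); apply: (fa_sub AX); exact: (fa_add AX).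
  - by apply: (fa_add AX); exact: (fa_scale AX).
  - move=> x; move: (u N x) (u N' x) (v N x) (v N' x) => y y' z z'.
    by have := sqr_ge0 ((y - y') - (z - z')); nra.
rewrite (st_add SX (fa_scale AX 2 bu2) (fa_scale AX 2 bv2)).
rewrite (st_scale SX _ bu2) (st_scale SX _ bv2).
have := H1 N N' a1 b1; have := H2 N N' a2 b2.
by set y := Rintegral _ _ _; set z := Rintegral _ _ _; lra.
Qed.

Let cauchy_seqZ a u : cauchy_seq u -> cauchy_seq (fun N x => a * u N x).
Proof.
move=> [bu cu]; split=> [N|e e0]; first exact: (fa_scale AX).
have a1 : 0 < a ^+ 2 + 1 by rewrite ltr_wpDl ?sqr_ge0.
have ea0 : 0 < e / (a ^+ 2 + 1) by rewrite divr_gt0.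
have [N0 HN0] := cu _ ea0; exists N0 => N N' NN NN'.
have bu2 := fa_sqr AX (fa_sub AX (bu N) (bu N')).
rewrite (_ : (fun x => _) = fun x => a ^+ 2 * (u N x - u N' x) ^+ 2); last first.
  by apply/funext => x; rewrite -mulrBr exprMn.
rewrite (st_scale SX _ bu2); have := HN0 _ _ NN NN'.
rewrite ler_pdivlMr// => HN; apply: le_trans HN.
rewrite mulrC ler_wpM2l ?lerDl//.
by apply: Rintegral_ge0 => x _; exact: sqr_ge0.
Qed.

Let cauchy_seq_sum (J : Type) (r : seq J) (u : J -> nat -> X -> R) :
  (forall j, cauchy_seq (u j)) -> cauchy_seq (fun N x => \sum_(j <- r) u j N x).
Proof.
move=> cu; elim: r => [|j r IH].
  split=> [N|e e0].
    rewrite (_ : (fun x => _) = fun=> 0); first exact: (fa_cst AX).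
    by apply/funext => x; rewrite big_nil.
  exists 0%N => N N' _ _; rewrite (_ : (fun x => _) = fun=> 0).
    by rewrite (st_cst AX SX) ltW.
  by apply/funext => x; rewrite !big_nil subrr expr0n.
rewrite (_ : (fun N x => _) = fun N x => u j N x + \sum_(j <- r) u j N x).
  exact: cauchy_seqD.
by apply/funext => N; apply/funext => x; rewrite big_cons.
Qed.

(** For fixed [s], [polynomial_cesaro_cauchy] applies to each word [w], and there are finitely many
    words. *)
Lemma orbit_sum_sampled_cauchy (s e : R) : 0 < e ->
  exists N0, forall N N', (N0 <= N)%N -> (N0 <= N')%N ->
    \int[mu]_x (sampled_avg orbit_sum N s x - sampled_avg orbit_sum N' s x) ^+ 2 <= e.
Proof.
have [r Hr] := deg_le_polynomial_map p_poly.
have [U [UU Uoo]] := @ultraFilterLemma nat \oo _.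
pose P w t x := \prod_i h i (w i) (tau (p i (s + t%:R)) x).
have bP w t : bounded_measurable (P w t).
  split.
    apply: measurable_prod => i _.
    exact: (measurableT_comp (bh i (w i)).1 (measurable_tau _)).
  have /choice[C hC] : forall i : 'I_k, exists C, forall x, `|h i (w i) x| <= C.
    by move=> i; have [_] := bh i (w i).
  exists (\prod_i C i) => x; rewrite normr_prod; apply: ler_prod => i _.
  by rewrite normr_ge0 hC.
have cw (w : {ffun 'I_k -> bool}) : cauchy_seq (fun N x => cesaro N (fun t => P w t x)).
  split; first by move=> N; exact: (fa_cesaro AX).
  move=> e1 e10; exact: (@polynomial_cesaro_cauchy _ _ _ _ _ _ invariant_state_tau U UU Uoo
    r 'I_k (index_enum _) (fun i t => p i (s + t%:R)) (fun i => h i (w i))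
    (fun i => Hr i s) (fun i => bh i (w i))).
have := cauchy_seq_sum (index_enum _) (fun w => cauchy_seqZ (c w) (cw w)).
move=> [_ H] e0; have [N0 HN0] := H _ e0; exists N0 => N N' NN NN'.
have E n x : sampled_avg orbit_sum n s x =
    \sum_(w : {ffun 'I_k -> bool}) c w * cesaro n (fun t => P w t x).
  rewrite /sampled_avg /orbit_sum.
  rewrite (st_sum (function_algebra_full _) (state_cesaro n) _
    (f := fun w t => c w * P w t x))//.
  by apply: eq_bigr => w _; rewrite cesaroZ.
by have := HN0 _ _ NN NN'; under eq_Rintegral do rewrite -!E.
Qed.

Lemma orbit_sum_cvg : exists g : X -> R, bounded_measurable g /\
  forall e : R, 0 < e -> exists T0, forall T, T0 <= T ->
    \int[mu]_x (time_avg orbit_sum T x - g x) ^+ 2 <= e.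
Proof.
have [K HK] := orbit_sum_bounded.
have mo := measurable_orbit_sum (fun i b => (bh i b).1).
apply: (time_avg_cvg mo HK).
exact: orbit_sum_sampled_cauchy.
Qed.

End real_averages.

(** By Tonelli and invariance, the pairs [(t, x)] with [tau (p i t) x] in a given null set form a
    null set. *)
Lemma ae_orbit (P : X -> Prop) i : {ae mu, forall x, P x} ->
  {ae mu, forall x, {ae leb, forall t, P (tau (p i t) x)}}.
Proof.
move=> [N [mN N0 PN]].
pose H (z : R * X) : \bar R := (\1_N (tau (p i z.1) z.2))%:E.
have mH : measurable_fun setT H.
  apply/measurable_EFinP.
  have mI : measurable_fun setT (\1_N : X -> R) by exact: measurable_indic.
  exact: (measurableT_comp mI (measurable_orbit i)).
have H0 z : (0 <= H z)%E by rewrite lee_fin.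
have := @fubini_tonelli _ _ _ _ _ leb mu H mH H0.
have -> : (\int[leb]_t \int[mu]_x H (t, x) = 0)%E.
  rewrite (eq_integral (cst 0%E)) ?integral0// => t _.
  rewrite /H /= (_ : (fun x => _) = EFin \o \1_(tau (p i t) @^-1` N)); last first.
    by apply/funext => x /=; rewrite !indicE.
  rewrite integral_indic// ?setIT ?tau_preserving//.
  by rewrite -[_ @^-1` _]setTI; exact: measurable_tau.
move=> /esym HE.
have mG : measurable_fun setT (fubini_G leb H).
  exact: measurable_fun_fubini_tonelli_G.
have /(ae_eq_integral_abs mu measurableT mG) : (\int[mu]_x `|fubini_G leb H x| = 0)%E.
  rewrite -[RHS]HE; apply: eq_integral => x _; rewrite gee0_abs//.
  by apply: integral_ge0 => t _.
apply: filterS => x /(_ I) /= Hx.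
have mHx : measurable_fun setT (fun t : measurableTypeR R => H (t, x)).
  exact: measurable_fun_pair1.
have /(ae_eq_integral_abs leb measurableT mHx) : (\int[leb]_t `|H (t, x)| = 0)%E.
  by rewrite -[RHS]Hx; apply: eq_integral => t _; rewrite gee0_abs.
apply: filterS => t /(_ I) /= Ht; apply: contrapT => nP.
have : N (tau (p i t) x) by exact: PN.
move: Ht; rewrite /H /= indicE => /eqP; rewrite eqe pnatr_eq0 eqb0 => /negP.
by move=> + Nt; apply; rewrite inE.
Qed.

(** One null set serves all [c] and [T]: off it, the two integrands agree at almost every time of
    the whole line. *)
Lemma ae_time_avg_orbit_sum (h h' : 'I_k -> bool -> X -> R) :
  (forall i b, measurable_fun setT (h i b)) ->
  (forall i b, measurable_fun setT (h' i b)) ->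
  (forall i b, {ae mu, forall x, h i b x = h' i b x}) ->
  {ae mu, forall x, forall c T,
    time_avg (orbit_sum h c) T x = time_avg (orbit_sum h' c) T x}.
Proof.
move=> mh mh' hh'.
have : {ae mu, forall x, forall ib : 'I_k * bool, {ae leb, forall t,
    h ib.1 ib.2 (tau (p ib.1 t) x) = h' ib.1 ib.2 (tau (p ib.1 t) x)}}.
  apply: (@filter_forall X _ (fun ib x => {ae leb, forall t,
    h ib.1 ib.2 (tau (p ib.1 t) x) = h' ib.1 ib.2 (tau (p ib.1 t) x)})
    (almost_everywhere mu)) => -[i b].
  exact: (ae_orbit _ (hh' i b)).
have FL : Filter (almost_everywhere leb) by exact: ae_filter_ringOfSetsType.
apply: filterS => x Hx c T; rewrite /time_avg; congr (_ * fine _).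
have mo g : (forall i b, measurable_fun setT (g i b)) ->
    measurable_fun `[0, T] (fun t : measurableTypeR R => (orbit_sum g c t x)%:E).
  move=> mg; apply: measurable_funTS; apply/measurable_EFinP.
  exact: (measurable_fun_pair1 x (measurable_orbit_sum c mg)).
apply: ae_eq_integral; [exact: measurable_itv|exact: mo|exact: mo|].
have : {ae leb, forall t, forall ib : 'I_k * bool,
    h ib.1 ib.2 (tau (p ib.1 t) x) = h' ib.1 ib.2 (tau (p ib.1 t) x)}.
  have := @filter_forall (measurableTypeR R) ('I_k * bool)%type
    (fun ib t => h ib.1 ib.2 (tau (p ib.1 t) x) =
    h' ib.1 ib.2 (tau (p ib.1 t) x)) (almost_everywhere leb) FL Hx.
  exact.
apply: filterS => t ht _; congr EFin; apply: eq_bigr => w _; congr (_ * _).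
by apply: eq_bigr => i _; exact: (ht (i, w i)).
Qed.

End flow.

(** * Complex products in real coordinates *)

Section complex_products.
Context {R : realType} {k : nat}.

Definition complex_part (b : bool) (z : R[i]) : R :=
  if b then complex.Im z else complex.Re z.

Definition unit_word (w : {ffun 'I_k -> bool}) : R[i] :=
  \prod_i (if w i then 'i%C else 1).

(** Write each factor as its real part plus the imaginary unit times its imaginary part, and
    distribute. *)
Lemma complex_part_prod b (z : 'I_k -> R[i]) :
  complex_part b (\prod_i z i) = \sum_(w : {ffun 'I_k -> bool})
    complex_part b (unit_word w) * \prod_i complex_part (w i) (z i).
Proof.
have zE i : z i = \sum_(c : bool)
    (if c then 'i%C else 1) * (complex_part c (z i))%:C%C.
  by rewrite big_bool /= mul1r addrC -complexE.
rewrite (eq_bigr _ (fun i _ => zE i)) bigA_distr_bigA /=.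
have partD x y : complex_part b (x + y) = complex_part b x + complex_part b y.
  by case: b; case: x => ? ?; case: y.
have part0 : complex_part b 0 = 0 by case: (b).
rewrite (big_morph (complex_part b) partD part0); apply: eq_bigr => w _.
rewrite big_split /= -(rmorph_prod (real_complex R)) -/(unit_word w).
case: (unit_word w) => u v; rewrite /complex_part.
by case: (b) => /=; rewrite !mulr0 ?subr0 ?add0r ?addr0.
Qed.

End complex_products.

Section essentially_bounded.
Context {R : realType} {d : measure_display} {X : measurableType d}.
Context {mu : probability X R}.

(** Clamping at an essential bound changes [r] only on a null set. *)
Lemma Lfun_infty_truncate (r : X -> R) : r \in Lfun mu +oo%E ->
  measurable_fun setT r /\ exists r' : X -> R, bounded_measurable r' /\
    {ae mu, forall x, r x = r' x}.
Proof.
move=> rL; have mr : measurable_fun setT r by exact: set_mem (sub_Lfun_mfun rL).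
split=> //.
have : finite_norm mu +oo%E r by exact: set_mem (sub_Lfun_finLfun rL).
rewrite /finite_norm unlock /= probability_setT lte01 => rfin.
have [C rC] := @ess_supr_bounded _ _ _ mu (Num.norm \o r) rfin.
exists (fun x => Num.max (- `|C|) (Num.min `|C| (r x))); split; first split.
- by apply: measurable_maxr => //; exact: measurable_minr.
- exists `|C| => x; rewrite ler_norml le_max lexx /= ge_max.
  by rewrite ge_min lexx /= andbT (le_trans _ (normr_ge0 C))// oppr_le0.
- apply: filterS rC => x /= rx.
  have := le_trans rx (ler_norm C); rewrite ler_norml => /andP[r1 r2].
  by rewrite min_r// max_r.
Qed.

Lemma bounded_Lfun2 (g : X -> R) : bounded_measurable g -> g \in Lfun mu 2%:E.
Proof.
move=> bg; have [mg [C gC]] := bg.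
rewrite inE; apply/andP; split; rewrite inE//=; rewrite /finite_norm unlock /=.
apply: poweR_lty.
have -> : (\int[mu]_x (`|g x|%:E `^ 2) = \int[mu]_x (g x ^+ 2)%:E)%E.
  apply: eq_integral => x _.
  by rewrite poweR_EFin powR_mulrn// real_normK ?num_real.
apply: integrable_lty => //; apply: bounded_measurable_integrable => //.
  by rewrite -ge0_fin_numE ?fin_num_measure.
exact: (fa_sqr function_algebra_bounded_measurable).
Qed.

End essentially_bounded.

(** The real and imaginary parts of the averages are time averages of orbit sums. Bounded
    representatives of the factors give the limits, and [ae_time_avg_orbit_sum] returns to the given
    functions. *)
Theorem theorem1p2 (R : realType) (D k : nat) (D_ge1 : (1 <= D)%N)
    (k_ge1 : (1 <= k)%N) (d : measure_display) (X : measurableType d)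
    (mu : probability X R) (X_standard : standard_borel R X)
    (tau : 'rV[R]_D -> X -> X) (tau_action : rV_action tau)
    (tau_measurable : jointly_measurable tau)
    (tau_preserving : preserves_measure tau mu)
    (p : 'I_k -> R -> 'rV[R]_D) (p_poly : forall i, polynomial_map (p i))
    (f : 'I_k -> X -> R[i]) (f_bounded : forall i, complex_Lfun mu +oo%E (f i)) :
  cvg_in_L2 mu (ergodic_average tau p f).
Proof.
pose h i b x := complex_part b (f i x).
have hL i b : h i b \in Lfun mu +oo%E by have [? ?] := f_bounded i; case: b.
have mh i b : measurable_fun setT (h i b) by have [] := Lfun_infty_truncate (hL i b).
have /choice[h1 Hh1] : forall ib : 'I_k * bool, exists r : X -> R,
    bounded_measurable r /\ {ae mu, forall x, h ib.1 ib.2 x = r x}.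
  by move=> [i b]; have [] := Lfun_infty_truncate (hL i b).
pose h' i b := h1 (i, b).
have bh' i b : bounded_measurable (h' i b) by have [] := Hh1 (i, b).
pose c b w := complex_part b (@unit_word R k w).
pose S b T := time_avg (orbit_sum (tau := tau) (p := p) h (c b)) T.
pose S' b T := time_avg (orbit_sum (tau := tau) (p := p) h' (c b)) T.
(* This holds at every [x], integrable or not: both sides integrate the same real function of
   [t]. *)
have SE T x b : complex_part b (ergodic_average tau p f T x) = S b T x.
  have E c' : complex_part c' (complex_integral lebesgue_measure `[0, T]
      (fun t : R => \prod_(i < k) f i (tau (p i t) x))) =
    \int[lebesgue_measure]_(t in `[0, T]) orbit_sum (tau := tau) (p := p) h (c c') t x.
    transitivity (\int[lebesgue_measure]_(t in `[0, T])
        complex_part c' (\prod_(i < k) f i (tau (p i t) x))); first by case: c'.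
    by apply: eq_Rintegral => t _; rewrite complex_part_prod.
  rewrite /S /time_avg -E /ergodic_average; case: (complex_integral _ _ _) => u v.
  by case: b; rewrite /= !mul0r ?subr0 ?addr0.
have aeS : {ae mu, forall x, forall b T, S b T x = S' b T x}.
  have := ae_time_avg_orbit_sum tau_measurable tau_preserving p_poly mh
    (fun i b => (bh' i b).1) (fun i b => (Hh1 (i, b)).2).
  by apply: filterS => x Hx b T; exact: Hx.
have /choice[g Hg] : forall b, exists g : X -> R, bounded_measurable g /\
    forall e : R, 0 < e -> exists T0, forall T, T0 <= T ->
    \int[mu]_x (S' b T x - g x) ^+ 2 <= e.
  by move=> b; exact: orbit_sum_cvg.
have bg b : bounded_measurable (g b) by have [] := Hg b.
exists (fun x => Complex (g false x) (g true x)).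
  by split; apply: bounded_Lfun2; exact: bg.
pose AX := @function_algebra_bounded_measurable R d X.
have SX : state (@bounded_measurable R d X) (fun f => \int[mu]_x f x).
  by apply: state_Rintegral => //; exact: probability_setT.
have muX : (mu setT < +oo)%E by rewrite -ge0_fin_numE ?fin_num_measure.
have bS' b T : bounded_measurable (S' b T).
  have [K HK] := orbit_sum_bounded (tau := tau) (p := p) (c b) bh'.
  have mo := measurable_orbit_sum tau_measurable p_poly (c b) (fun i b => (bh' i b).1).
  split; last by exists K; exact: time_avg_norm mo HK _.
  apply: measurable_funM => //.
  exact: (measurable_Rintegral lebesgue_measure (measurable_itv _) mo).
have mS b T : measurable_fun setT (S b T).
  have mo := measurable_orbit_sum tau_measurable p_poly (c b) mh.
  apply: measurable_funM => //.
  exact: (measurable_Rintegral lebesgue_measure (measurable_itv _) mo).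
pose q T x := (S' false T x - g false x) ^+ 2 + (S' true T x - g true x) ^+ 2.
have bu b T : bounded_measurable (fun x => (S' b T x - g b x) ^+ 2).
  by apply: (fa_sqr AX); exact: (fa_sub AX).
have bq T : bounded_measurable (q T) by exact: (fa_add AX).
have normE T : complex_Lnorm mu 2%:E (fun x => ergodic_average tau p f T x -
    Complex (g false x) (g true x)) = (Num.sqrt (\int[mu]_x q T x))%:E.
  have q0 : 0 <= \int[mu]_x q T x.
    by apply: Rintegral_ge0 => x _; rewrite addr_ge0 ?sqr_ge0.
  rewrite /complex_Lnorm unlock /=.
  have -> : (\int[mu]_x (`|(ComplexField.Normc.normc
      (ergodic_average tau p f T x - Complex (g false x) (g true x)))%:E| `^ 2) =
      \int[mu]_x (q T x)%:E)%E.
    transitivity (\int[mu]_x ((S false T x - g false x) ^+ 2 +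
        (S true T x - g true x) ^+ 2)%:E)%E.
      apply: eq_integral => x _; rewrite -!SE.
      case: (ergodic_average tau p f T x) => u v /=.
      rewrite powR_mulrn// real_normK ?num_real//.
      by rewrite sqr_sqrtr// addr_ge0 ?sqr_ge0.
    apply: ae_eq_integral => //.
    - apply/measurable_EFinP; apply: measurable_funD; apply: measurable_funX;
        apply: measurable_funB => //; exact: (bg _).1.
    - by apply/measurable_EFinP; exact: (bq T).1.
    - by apply: filterS aeS => x Sx _; rewrite !Sx.
  rewrite -[X in (X `^ _)%E]fineK.
    by rewrite poweR_EFin powR12_sqrt.
  by apply: integrable_fin_num => //; exact: bounded_measurable_integrable.
rewrite (_ : (fun T => _) = EFin \o (fun T => Num.sqrt (\int[mu]_x q T x)));
  last by apply/funext => T; rewrite normE.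
apply: cvg_EFin; first exact: nearW.
apply/cvgrPdist_le => e e0.
(* The norm is the square root of a sum of two integrals, one for each part. *)
have e20 : 0 < e ^+ 2 / 2 by rewrite divr_gt0// exprn_gt0.
have [T1 H1] := (Hg false).2 _ e20; have [T2 H2] := (Hg true).2 _ e20.
exists (Num.max T1 T2); split; first exact: num_real.
move=> T; rewrite gt_max => /andP[T1T T2T].
rewrite sub0r normrN ger0_norm ?sqrtr_ge0// -(ger0_norm (ltW e0)) -sqrtr_sqr.
rewrite ler_wsqrtr// /q (st_add SX (bu false T) (bu true T)).
by rewrite [leRHS]splitr lerD//; [exact/H1/ltW|exact/H2/ltW].
Qed.
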